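(* Let $\mu$ be a probability measure on $\mathbb{Z}$ supported on a finite set of at least two elements. There is a (possibly empty) set of primes $B$ such that for every $X\ge 1$, $$\sum_{p\in B\cap[e^{X/2},e^X]}\frac1p\le\frac{(\log X)^6}{\sqrt X},$$ and with the following property. For all $\varepsilon,\delta\in(0,1)$ there is a constant $p_0$ depending only on $\mu,\varepsilon,\delta$ such that if $p>p_0$ is a prime with $p\notin B$, then for all but an $\varepsilon$-fraction of all $a\in\mathbb{F}_p^\times$, the mixing times of the Markov chain $x_{n+1}=ax_n+b_n$ on $\mathbb{F}_p$ (with $b_n$ the reductions mod $p$ of i.i.d. integer random variables of law $\mu$) satisfy $$T(\delta)\le T_2(\delta)\le\frac{5}{H_2(\mu)}\log p.$$
   Context: For a prime $p$, $u$ is the uniform probability measure on $\mathbb{F}_p$. For $a\in\mathbb{F}_p^\times$, consider the Markov chain $x_{n+1}=ax_n+b_n$ on $\mathbb{F}_p$, started at $x_0=0$, where the $b_n$ are the reductions mod $p$ of independent integer-valued random variables with common law $\mu$ (independent of $p$); $\mu_a^{(n)}$ denotes the law of $x_n$ on $\mathbb{F}_p$. The total variation distance is $\|\pi_1-\pi_2\|_{TV}=\sup_{A\subset\mathbb{F}_p}|\pi_1(A)-\pi_2(A)|$, and $\|f\|_2^2=\sum_{x\in\mathbb{F}_p}|f(x)|^2$ for $f:\mathbb{F}_p\to\mathbb{R}$. The mixing times are $T(\delta)=\inf\{n\in\mathbb{N}:\|\mu_a^{(n)}-u\|_{TV}\le\delta\}$ and $T_2(\delta)=\inf\{n\in\mathbb{N}:p\|\mu_a^{(n)}-u\|_2^2\le\delta^2\}$.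 Also $H_2(\mu)=-\log\sum_{z\in\mathbb{Z}}\mu(z)^2$. *)

(* Defs.v *)
From HB Require Import structures.
From mathcomp Require Import all_boot all_order all_algebra finmap.
From mathcomp Require Import all_classical all_reals all_analysis.

Set Implicit Arguments.
Unset Strict Implicit.
Unset Printing Implicit Defensive.

Import Order.TTheory GRing.Theory Num.Theory.

Local Open Scope classical_set_scope.
Local Open Scope ring_scope.

(* A finitely supported measure on the integers is given by its mass function,
   whose support [finsupp mu] is finite by typing. *)
Definition is_probability (R : realType) (mu : {fsfun int -> R with 0}) :=
  (forall z, 0 <= mu z) /\ \sum_(z <- finsupp mu) mu z = 1.

Definition H2 (R : realType) (mu : {fsfun int -> R with 0}) : R :=
  - ln (\sum_(z <- finsupp mu) mu z ^+ 2).

Section RandomWalk.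
Variables (R : realType) (p : nat).

Definition uniform_law (x : 'F_p) : R := p%:R^-1.

Definition tv_dist (f g : 'F_p -> R) : R :=
  sup (range (fun A : {set 'F_p} =>
    `| \sum_(x in A) f x - \sum_(x in A) g x |)).

Definition l2norm_sq (f : 'F_p -> R) : R := \sum_x `|f x| ^+ 2.

(* Position after the increments [b = [:: b_0; ...; b_(n-1)]], from [x_0 = 0]. *)
Definition chain (a : 'F_p) (b : seq int) : 'F_p :=
  foldl (fun x z => a * x + z%:~R) 0 b.

(* Law of [x_n]: the [n] independent increments range over the finite product
   space [(finsupp mu)^n], which carries the product of [n] copies of [mu]. *)
Definition law (mu : {fsfun int -> R with 0}) (a : 'F_p) (n : nat)
    (x : 'F_p) : R :=
  \sum_(b : n.-tuple (finsupp mu) | chain a [seq val z | z <- b] == x)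
    \prod_(z <- b) mu (val z).

(* Mixing times are extended reals, the infimum of the empty set being +oo. *)
Definition Tmix (mu : {fsfun int -> R with 0}) (a : 'F_p) (delta : R) : \bar R :=
  ereal_inf [set n%:R%:E | n in
    [set n : nat | tv_dist (law mu a n) uniform_law <= delta]].

Definition T2mix (mu : {fsfun int -> R with 0}) (a : 'F_p) (delta : R) : \bar R :=
  ereal_inf [set n%:R%:E | n in
    [set n : nat | p%:R * l2norm_sq (fun x => law mu a n x - uniform_law x)
                     <= delta ^+ 2]].

End RandomWalk.

(* Main.v *)
Require Import Defs.
From HB Require Import structures.
From mathcomp Require Import all_boot all_order all_algebra all_field finmap.
From mathcomp Require Import all_classical all_reals all_analysis.
From mathcomp Require Import ring lra zify.
Set Implicit Arguments.
Unset Strict Implicit.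
Unset Printing Implicit Defensive.
Import Order.TTheory GRing.Theory Num.Theory.
Local Open Scope ring_scope.

(* Write rho_p(a) = sum_x law_n(x)^2, the probability that the difference D of
   two random polynomials with i.i.d. coefficients of law mu vanishes at a mod p,
   where n is about log p / H_2(mu).  Averaged over a and over the primes
   p of size e^Y, Y < (3/2) log p, the quantity p * rho_p(a) is governed by the
   number of roots mod p of a nonzero D.

   To count these roots, compare D with all integer polynomials F of degree < m
   and coefficients below H, with m ~ Y / log Y and H^m > 2 e^Y.  Each root
   of D mod p is a root of a proportion >= 1/(2p) of the F, while the product of
   p^#{common roots of D and F mod p} divides a resultant bounded through the
   Mahler measure of D.  This gives sum_p (1/p) #roots = O(log Y), provided
   that F and D have no common factor.  An irreducible factor Q of D of degree
   < m has Mahler measure polynomial in Y, so by the pigeonhole principle (modulo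
   an integer l prime to its leading coefficient) it divides a polynomial of degree
   < 2m with coefficients polynomial in Y; the roots of all such polynomials
   form a set of size at most e^(Y/2), which is simply removed.

   Hence p * rho_p(a) <= sqrt Y / (log Y)^2 up to constants for most a, unless p lies
   in a sparse set B.  Finally, for any mean-zero h the squared norms of
   law_n(./c) * h, summed over c in F_p, give p * rho_p(a) * |h|^2; using the m
   distinct dilations c = a^(n+j), j < m, this improves the bound to
   p * |law_{3n} - u|^2 <= (p * rho_p(a))^2 / m, which tends to 0. *)

Local Notation pC P := (map_poly (intmul (1 : algC)) P).
Local Notation pF p P := (map_poly (intmul (1 : 'F_p)) P).
Local Notation pQ P := (map_poly (intmul (1 : rat)) P).

(** * Resultants through Newton bases *)

Section Newton.
Variable (K : comNzRingType).
Implicit Types (x : nat -> K) (P G : {poly K}).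

Definition newton x (k : nat) : {poly K} := \prod_(i < k) ('X - (x i)%:P).

Lemma newtonS x k : newton x k.+1 = newton x k * ('X - (x k)%:P).
Proof. by rewrite /newton big_ord_recr. Qed.

Lemma monic_newton x k : newton x k \is monic.
Proof. exact: monic_prod_XsubC. Qed.

Lemma size_newton x k : size (newton x k) = k.+1.
Proof.
elim: k => [|k IH]; first by rewrite /newton big_ord0 size_poly1.
rewrite newtonS size_Mmonic ?monicXsubC ?monic_neq0 ?monic_newton //.
by rewrite IH size_XsubC addn2.
Qed.

(** Divide [G] by ['X - x j]: the remainder is the coefficient of [newton x j], and the quotient is
    expanded by induction. The [j] leading zeros later make matrices triangular. *)
Lemma newton_expand x N j G : (size G + j <= N)%N ->
  exists t : nat -> K,
    [/\ forall k, (k < j)%N -> t k = 0, (j < N)%N -> t j = G.[x j] &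
        newton x j * G = \sum_(k < N) t k *: newton x k].
Proof.
have [s] := ubnP (size G); elim: s j G => // s IH j G sG sGN.
have [->|G0] := eqVneq G 0.
  exists (fun=> 0); split=> //; first by rewrite horner0.
  by rewrite mulr0 big1 // => k _; rewrite scale0r.
have [G' DG] : exists G', G - (G.[x j])%:P = G' * ('X - (x j)%:P).
  by apply/factor_theorem; rewrite rootE !hornerE subrr.
have sG' : (size G' < size G)%N.
  have [->|G'0] := eqVneq G' 0; first by rewrite size_poly0 lt0n size_poly_eq0.
  have: (size (G' * ('X - (x j)%:P))%R <= size G)%N.
    rewrite -DG (leq_trans (size_polyD _ _)) // size_polyN size_polyC geq_max leqnn.
    by rewrite (leq_trans (leq_b1 _)) // lt0n size_poly_eq0.
  by rewrite size_Mmonic ?monicXsubC // size_XsubC addn2.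
have [t [t0 tj Dt]] := IH j.+1 G' (leq_trans sG' sG)
  ltac:(by rewrite addnS (leq_trans _ sGN) // -addSn leq_add2r).
have jN : (j < N)%N.
  by rewrite (leq_trans _ sGN) // -[X in (X < _)%N]add0n ltn_add2r lt0n size_poly_eq0.
exists (fun k => t k + G.[x j] *+ (k == j)); split.
- by move=> k kj; rewrite t0 ?ltnS ?(ltnW kj) // (ltn_eqF kj) addr0.
- by rewrite t0 // eqxx add0r.
under eq_bigr do rewrite scalerDl.
rewrite big_split /= -Dt newtonS (bigD1 (Ordinal jN)) //= eqxx big1 ?addr0.
  have {1}-> : G = G' * ('X - (x j)%:P) + G.[x j]%:P by rewrite -DG subrK.
  by rewrite mulr1n -mul_polyC; ring.
by move=> k /negPf; rewrite -val_eqE /= => ->; rewrite scale0r.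
Qed.

Definition coefmx N (P : 'I_N -> {poly K}) : 'M[K]_N := \matrix_(i, k) (P i)`_k.

Lemma coefmxM N (T : 'M[K]_N) (P W : 'I_N -> {poly K}) :
  (forall i, P i = \sum_k T i k *: W k) -> coefmx P = T *m coefmx W.
Proof.
move=> DP; apply/matrixP=> i k; rewrite !mxE DP coef_sum.
by apply: eq_bigr => l _; rewrite coefZ mxE.
Qed.

Lemma det_newton_mx x N : \det (coefmx (fun i : 'I_N => newton x i)) = 1.
Proof.
rewrite det_trig; last first.
  by apply/is_trig_mxP => i k ik; rewrite mxE nth_default // size_newton.
rewrite big1 // => i _; rewrite mxE.
by have /monicP := monic_newton x i; rewrite lead_coefE size_newton.
Qed.

(** The change from monomials to a Newton basis is unitriangular over any commutative ring, so
    integer nodes keep the coordinates [T] integral. *)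
Lemma newton_coefmx x N (P : 'I_N -> {poly K}) : (forall i, size (P i) <= N)%N ->
  exists T : 'M[K]_N, (forall i, P i = \sum_k T i k *: newton x k) /\
     \det (coefmx P) = \det T.
Proof.
move=> sP.
have H i : exists t : nat -> K, P i = \sum_(k < N) t k *: newton x k.
  have [|t [_ _ Dt]] := @newton_expand x N 0 (P i); first by rewrite addn0.
  by exists t; rewrite -Dt /newton big_ord0 mul1r.
have /choice [t Dt] := H.
exists (\matrix_(i, k) t i k); split=> [i|].
  by rewrite Dt; apply: eq_bigr => k _; rewrite mxE.
rewrite (@coefmxM _ (\matrix_(i, k) t i k) _ (fun i => newton x i)).
  by rewrite det_mulmx det_newton_mx mulr1.
by move=> i; rewrite Dt; apply: eq_bigr => k _; rewrite mxE.
Qed.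

End Newton.

Section Sylvester.
Variable (K : comNzRingType).
Implicit Types (Q F : {poly K}).

(** Rows of the Sylvester matrix, for formal degrees [d] and [e] that may exceed the true ones. *)
Definition sylv Q F d e (i : 'I_(d + e)) : {poly K} :=
  if (i < d)%N then 'X^i * F else 'X^(i - d) * Q.

Lemma size_sylv Q F d e (i : 'I_(d + e)) :
  (size Q <= d.+1)%N -> (size F <= e.+1)%N -> (size (sylv Q F i) <= d + e)%N.
Proof.
have sX (G : {poly K}) k : (size ('X^k * G)%R <= k + size G)%N.
  have [->|G0] := eqVneq G 0; first by rewrite mulr0 size_poly0.
  by rewrite mulrC size_Mmonic ?monicXn // size_polyXn addnS addnC.
rewrite /sylv => sQ sF; case: ltnP => id; apply: leq_trans (sX _ _) _.
  by apply: leq_trans (leq_add (leqnn i) sF) _; rewrite addnS -addSn leq_add2r.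
apply: leq_trans (leq_add (leqnn _) sQ) _.
by have := ltn_ord i; lia.
Qed.

(* Replacing the rows [X^i F] by [newton x i * F], a unimodular change, makes the
   matrix triangular in the Newton basis of the roots of Q. *)
Lemma det_sylv (c : K) (x : nat -> K) F d e : (size F <= e.+1)%N ->
  \det (coefmx (@sylv (c *: newton x d) F d e)) = c ^+ e * \prod_(i < d) F.[x i].
Proof.
(* Padding the nodes with 0 turns the Newton polynomials from index [d] on into [newton x d * 'X^k],
   which are the rows of [Q] up to the factor [c]. *)
move=> sF; pose y i := if (i < d)%N then x i else 0.
have Dy k : (k <= d)%N -> newton x k = newton y k.
  move=> kd; apply: eq_bigr => i _.
  by rewrite /y (leq_trans (ltn_ord i) kd).
have DyX k : newton y (d + k) = newton y d * 'X^k.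
  elim: k => [|k IH]; first by rewrite addn0 mulr1.
  by rewrite addnS newtonS IH /y ltnNge leq_addr /= subr0 exprSr mulrA.
pose Q := c *: newton x d.
pose V (i : 'I_(d + e)) := if (i < d)%N then newton y i * F else 'X^(i - d) * Q.
pose U : 'M[K]_(d + e) :=
  \matrix_(i, k) if (i < d)%N then (newton y i)`_k else (i == k)%:R.
have detU : \det U = 1.
  rewrite det_trig; last first.
    apply/is_trig_mxP => i k ik; rewrite mxE; case: ifP => _.
      by rewrite nth_default // size_newton.
    by rewrite -val_eqE /= (ltn_eqF ik).
  rewrite big1 // => i _; rewrite mxE eqxx; case: ifP => // _.
  by have /monicP := monic_newton y i; rewrite lead_coefE size_newton.
have VU : coefmx V = U *m coefmx (@sylv Q F d e).
  apply: coefmxM => i; rewrite /V; case: (ltnP i d) => id; last first.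
    rewrite (bigD1 i) //= big1 ?addr0 ?mxE ?ltnNge ?id /= ?eqxx ?scale1r.
      by rewrite /sylv ltnNge id.
    by move=> k /negPf ki; rewrite mxE ltnNge id /= eq_sym ki scale0r.
  have -> : newton y i = \sum_(k < d + e) (newton y i)`_k *: 'X^k.
    rewrite -poly_def; apply/polyP => k; rewrite coef_poly.
    case: ltnP => // kde; rewrite nth_default // size_newton.
    by rewrite (leq_trans _ kde) // ltn_ord.
  rewrite mulr_suml; apply: eq_bigr => k _; rewrite mxE id /sylv.
  rewrite -scalerAl; case: ltnP => // dk.
  by rewrite nth_default ?scale0r // size_newton (leq_trans id).
have DV (i : 'I_(d + e)) : exists t : nat -> K,
  [/\ forall k, (k < i)%N -> t k = 0,
      t i = if (i < d)%N then F.[x i] else c &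
      V i = \sum_(k < d + e) t k *: newton y k].
  rewrite /V; case: ltnP => id.
    have [|t [t0 ti Dt]] := @newton_expand _ y (d + e) i F.
      by apply: leq_trans (leq_add sF (leqnn i)) _; lia.
    by exists t; split=> //; rewrite ti // /y id.
  exists (fun k : nat => c *+ (k == i :> nat)); split=> [k ki||].
  - by rewrite (ltn_eqF ki).
  - by rewrite eqxx.
  rewrite (bigD1 i) //= eqxx big1 ?addr0; last first.
    by move=> k; rewrite -val_eqE /= => /negPf ->; rewrite scale0r.
  have -> : newton y i = newton y d * 'X^(i - d) by rewrite -DyX subnKC.
  by rewrite mulr1n /Q Dy // -scalerAr mulrC.
have /choice [t Dt] := DV.
have VT : coefmx V = (\matrix_(i, k) t i k) *m coefmx (fun i => newton y i).
  apply: coefmxM => i; have [_ _ ->] := Dt i.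
  by apply: eq_bigr => k _; rewrite mxE.
have := congr1 determinant VU; rewrite det_mulmx detU mul1r => <-.
rewrite VT det_mulmx det_newton_mx mulr1 -det_tr det_trig; last first.
  by apply/is_trig_mxP => i k ik; rewrite !mxE; have [t0 _ _] := Dt k; rewrite t0.
rewrite big_split_ord /= mulrC; congr (_ * _).
  rewrite -[e in RHS]card_ord -prodr_const; apply: eq_bigr => i _; rewrite !mxE.
  by have [_ -> _] := Dt (rshift d i); rewrite /= ltnNge leq_addr.
apply: eq_bigr => i _; rewrite !mxE; have [_ -> _] := Dt (lshift e i).
by rewrite /= ltn_ord.
Qed.

End Sylvester.

Lemma Fp_intr_eq0 p (z : int) : prime p -> (z%:~R == 0 :> 'F_p) = (p %| z)%Z.
Proof. by move=> pp; rewrite -(dvdz_pcharf (pchar_Fp pp)). Qed.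

(* In a Newton basis at lifts of the points of A, the first #|A| coordinates of each
   row are divisible by p. *)
Lemma prime_dvd_det p N (P : 'I_N -> {poly int}) (A : {set 'F_p}) :
  prime p -> (forall i, size (P i) <= N)%N -> (#|A| <= N)%N ->
  (forall i a, a \in A -> (map_poly (intmul 1) (P i)).[a] = 0) ->
  ((p ^ #|A|)%:Z %| \det (coefmx P))%Z.
Proof.
move=> pp sP AN PA; set r := #|A|.
pose s k : 'F_p := nth 0 (enum A) k.
have sA k : (k < r)%N -> s k \in A.
  by move=> kr; rewrite -mem_enum mem_nth // -cardE.
pose x k : int := (s k : nat)%:Z.
have xs k : (x k)%:~R = s k by rewrite /x /= -pmulrn natr_Zp.
have [T [DP ->]] := newton_coefmx x sP.
(* At the [k]-th point of [A], terms of index below [k] vanish mod [p] by induction and those above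
   contain a vanishing factor. There remains [T i k] times differences of distinct points. *)
have T0 i (k : 'I_N) : (k < r)%N -> (p %| T i k)%Z.
  have [m] := ubnP (k : nat); elim: m k => // m IH k /ltnSE km kr.
  have := PA i _ (sA _ kr); rewrite DP rmorph_sum horner_sum (bigD1 k) //= big1.
    rewrite addr0 -mul_polyC rmorphM /= map_polyC /= hornerM hornerC.
    rewrite /newton rmorph_prod horner_prod => /eqP.
    rewrite mulf_eq0 Fp_intr_eq0 // => /orP[//|/eqP/eqP].
    rewrite prodf_seq_eq0 => /hasP[/= j _].
    rewrite map_polyXsubC /= !hornerE xs subr_eq0 nth_uniq ?enum_uniq -?cardE //.
      by move/eqP=> jk; have := ltn_ord j; rewrite -jk ltnn.
    by rewrite (ltn_trans _ kr).
  move=> l lk; rewrite -mul_polyC rmorphM /= map_polyC /= hornerM hornerC.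
  have [kl|kl|/val_inj kl] := ltngtP l k; last by rewrite kl eqxx in lk.
    have /eqP-> : (T i l)%:~R == 0 :> 'F_p.
      by rewrite Fp_intr_eq0 // IH // ?(leq_trans kl) // ltnW.
    by rewrite mul0r.
  rewrite /newton rmorph_prod horner_prod (bigD1 (Ordinal kl)) //=.
  by rewrite map_polyXsubC /= hornerXsubC xs subrr mul0r mulr0.
pose d : 'rV[int]_N := \row_k (if (k < r)%N then p%:Z else 1).
pose T' : 'M[int]_N := \matrix_(i, k) (if (k < r)%N then (T i k %/ p)%Z else T i k).
have -> : T = T' *m diag_mx d.
  apply/matrixP => i k; rewrite mul_mx_diag !mxE; case: ifP => kr.
    by rewrite divzK // T0.
  by rewrite mulr1.
rewrite det_mulmx det_diag dvdz_mull //.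
have -> : \prod_i d 0 i = (p ^ r)%:Z; last by rewrite dvdzz.
rewrite (eq_bigr (fun i : 'I_N => if (i < r)%N then p%:Z else 1)); last first.
  by move=> i _; rewrite mxE.
rewrite -big_mkcond /= -(big_ord_widen N (fun=> p%:Z) AN) prodr_const card_ord.
by rewrite -!natz natrX.
Qed.

(** * Mahler measure *)

(** The roots are carried as a list with multiplicities, so that products of polynomials become
    concatenations. *)
Definition root_seq (P : {poly int}) (r : seq algC) :=
  pC P = (lead_coef P)%:~R *: \prod_(z <- r) ('X - z%:P).

Lemma root_seq_exists P : exists r, root_seq P r.
Proof.
have [r Dr] := closed_field_poly_normal (pC P); exists r.
rewrite /root_seq {1}Dr; congr (_ *: _).
by rewrite lead_coef_map_inj //; exact: intr_inj.
Qed.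

Lemma size_root_seq P r : root_seq P r -> P != 0 -> size P = (size r).+1.
Proof.
move=> Dr P0; rewrite -(size_map_inj_poly (@intr_inj algC)) // Dr size_scale.
  by rewrite size_prod_XsubC.
by rewrite intr_eq0 lead_coef_eq0.
Qed.

Lemma root_seqM P Q r s : root_seq P r -> root_seq Q s -> root_seq (P * Q) (r ++ s).
Proof.
move=> Dr Ds; rewrite /root_seq rmorphM /= Dr Ds lead_coefM rmorphM /= big_cat /=.
by rewrite -scalerAl -scalerAr scalerA.
Qed.

(** One integer, the Sylvester determinant, is evaluated over [algC] by [det_sylv] and mod [p] by
    [prime_dvd_det]: each distinct common root contributes a factor [p]. *)
Lemma resultant_int (Q F : {poly int}) r e : root_seq Q r -> Q != 0 -> (size F <= e.+1)%N ->
  exists z : int, z%:~R = (lead_coef Q)%:~R ^+ e * \prod_(a <- r) (pC F).[a] /\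
    forall p (A : {set 'F_p}), prime p -> (#|A| <= size r + e)%N ->
      (forall a, a \in A -> (pF p Q).[a] = 0 /\ (pF p F).[a] = 0) ->
      ((p ^ #|A|)%:Z %| z)%Z.
Proof.
move=> Dr Q0 sF; set d := size r.
exists (\det (coefmx (@sylv int Q F d e))); split; last first.
  move=> p A pp sA QFA; apply: prime_dvd_det => //.
    by move=> i; apply: size_sylv; rewrite ?(size_root_seq Dr).
  move=> i a /QFA [Qa Fa]; rewrite /sylv.
  by case: ifP => _; rewrite rmorphM hornerM ?Qa ?Fa mulr0.
rewrite -det_map_mx.
have DQ : pC Q = (lead_coef Q)%:~R *: newton (nth 0 r) d.
  by rewrite Dr /newton (big_nth 0) big_mkord.
rewrite (big_nth 0) big_mkord -(det_sylv _ (nth 0 r)); last first.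
  by rewrite size_map_inj_poly //; exact: intr_inj.
rewrite -DQ; congr (\det _); apply/matrixP => i k; rewrite !mxE /sylv -coef_map.
by case: ifP => _; rewrite rmorphM /= map_polyXn.
Qed.

Definition mahler (P : {poly int}) (r : seq algC) : algC :=
  `|(lead_coef P)%:~R| * \prod_(z <- r) Num.max 1 `|z|.

Lemma mahlerM P Q r s : mahler (P * Q) (r ++ s) = mahler P r * mahler Q s.
Proof.
by rewrite /mahler lead_coefM rmorphM normrM big_cat /= mulrACA.
Qed.

Lemma max1_ge1 (z : algC) : 1 <= Num.max 1 `|z|.
Proof. by rewrite comparable_le_max ?lexx // real_comparable ?normr_real. Qed.

Lemma mahler_ge_lead P r : `|(lead_coef P)%:~R| <= mahler P r.
Proof.
rewrite /mahler -[X in X <= _]mulr1 ler_wpM2l //.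
by elim/big_ind: _ => // [x y|z _]; [exact: mulr_ege1 | exact: max1_ge1].
Qed.

Lemma mahler_ge1 P r : P != 0 -> 1 <= mahler P r.
Proof.
move=> P0; apply: le_trans (mahler_ge_lead P r).
by rewrite -intr_norm ler1z -gtz0_ge1 normr_gt0 lead_coef_eq0.
Qed.

Definition norm1 (P : {poly int}) : nat := \sum_(i < size P) `|(P`_i)%R|%N.

Lemma norm1_horner (P : {poly int}) (e : nat) (z : algC) : (size P <= e.+1)%N ->
  `|(pC P).[z]| <= (norm1 P)%:R * Num.max 1 `|z| ^+ e.
Proof.
move=> sP; rewrite horner_coef size_map_inj_poly //; last exact: intr_inj.
apply: le_trans (ler_norm_sum _ _ _) _.
rewrite /norm1 natr_sum mulr_suml; apply: ler_sum => i _.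
rewrite coef_map /= normrM normrX -intr_norm natr_absz ler_wpM2l ?ler0z //.
have ie : (i <= e)%N by rewrite -ltnS (leq_trans (ltn_ord i)).
apply: (@le_trans _ _ (Num.max 1 `|z| ^+ i)).
  by rewrite lerXn2r ?nnegrE ?normr_ge0 ?(le_trans ler01) ?max1_ge1 //
    comparable_le_max ?lexx ?orbT // real_comparable ?normr_real.
by rewrite ler_weXn2l // max1_ge1.
Qed.

(** Each value of [F] is bounded by [norm1_horner]; the powers of [max 1 |a|] and of the leading
    coefficient assemble into the Mahler measure. *)
Lemma resultant_le (Q F : {poly int}) r e : root_seq Q r -> (size F <= e.+1)%N ->
  `|(lead_coef Q)%:~R ^+ e * \prod_(a <- r) (pC F).[a]|
    <= mahler Q r ^+ e * (norm1 F)%:R ^+ size r.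
Proof.
move=> Dr sF; rewrite normrM normrX /mahler exprMn -mulrA ler_wpM2l ?exprn_ge0 //.
rewrite normr_prod -prodrXl.
have -> : (norm1 F)%:R ^+ size r = \prod_(a <- r) (norm1 F)%:R :> algC.
  by rewrite big_const_seq count_predT -Monoid.iteropE.
rewrite -big_split /=; apply: ler_prod => z _; rewrite normr_ge0 /=.
by rewrite mulrC norm1_horner.
Qed.

(** * Low-degree factors *)

(* Irreducibility up to constant factors: D need not be primitive. *)
Definition indecomposable (D : {poly int}) :=
  forall D1 D2, D = D1 * D2 -> (size D1 <= 1)%N \/ (size D2 <= 1)%N.

(** The gcd of [D] and [P] over the rationals vanishes at [z], so it is not constant. Gauss's lemma
    makes it an integer factor of [D] up to a scalar; the cofactor must be constant, so [D] is
    proportional to the gcd. *)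
Lemma indecomposable_dvd (D P : {poly int}) (z : algC) :
  (1 < size D)%N -> indecomposable D -> root (pC D) z -> root (pC P) z ->
  pQ D %| pQ P.
Proof.
move=> sD irrD Dz Pz; have D0 : D != 0 by rewrite -size_poly_eq0; case: size sD.
have CQ (G : {poly int}) : pC G = map_poly ratr (pQ G).
  by rewrite -map_poly_comp; apply: eq_map_poly => k /=; rewrite ratr_int.
set g := gcdp (pQ D) (pQ P).
have gz : root (map_poly ratr g) z by rewrite gcdp_map root_gcd -!CQ Dz.
have DQ0 : pQ D != 0 by rewrite map_poly_eq0_id0 // intr_eq0 lead_coef_eq0.
have g0 : g != 0 by rewrite gcdp_eq0 (negPf DQ0).
have sg : (1 < size g)%N.
  rewrite ltnNge; apply/negP => /size1_polyC Dg.
  move: gz g0; rewrite Dg map_polyC rootC polyC_eq0 /= fmorph_eq0 => /eqP->.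
  by rewrite eqxx.
have [p1 [a a0 Dg] [r Dr]] := dvdpP_rat_int (dvdp_gcdl _ _ : g %| pQ D).
have sp1 : size p1 = size g.
  by rewrite Dg size_scale // size_map_inj_poly //; exact: intr_inj.
have sr : (size r <= 1)%N by case: (irrD _ _ Dr) => //; rewrite sp1 leqNgt sg.
apply: dvdp_trans (dvdp_gcdr (pQ D) _ : g %| pQ P).
rewrite Dr (size1_polyC sr) rmorphM /= map_polyC /= mulrC mul_polyC Dg.
rewrite dvdpZr // dvdpZl // intr_eq0; apply/eqP => r0.
by case/eqP: D0; rewrite Dr (size1_polyC sr) r0 mulr0.
Qed.

(** [pQ D] is a rational [b] times an integer divisor [q1] of [P]. If [p] divided the numerator of
    [b], comparing leading coefficients would make it divide that of [D]; hence a root of [D] mod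
    [p] is a root of [q1]. *)
Lemma rat_dvd_root_mod (D P : {poly int}) p (a : 'F_p) :
  prime p -> ~~ (p %| lead_coef D)%Z -> pQ D %| pQ P ->
  (pF p D).[a] = 0 -> (pF p P).[a] = 0.
Proof.
move=> pp pD /dvdpP_rat_int [q1 [b b0 Dq] [s ->]] Da.
rewrite rmorphM hornerM.
have E : denq b *: D = numq b *: q1.
  apply: (map_inj_poly (@intr_inj rat)) => //.
  rewrite -!mul_polyC !rmorphM /= !map_polyC /= !mul_polyC Dq scalerA.
  by congr (_ *: _); rewrite -{2}(divq_num_den b) mulrC divfK // intr_eq0 denq_eq0.
have := congr1 (fun G => (pF p G).[a]) E.
rewrite -!mul_polyC !rmorphM /= !hornerM Da mulr0 map_polyC hornerC /=.
move/esym/eqP; rewrite mulf_eq0 Fp_intr_eq0 // => /orP[pn|/eqP->]; last by rewrite mul0r.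
have := congr1 lead_coef E; rewrite !lead_coefZ => El.
have : (p %| denq b * lead_coef D)%Z by rewrite El dvdz_mulr.
have pb : coprimez p (denq b).
  rewrite coprimezE absz_nat prime_coprime //; apply/negP => pd.
  have := coprime_num_den b; rewrite /coprime => /eqP Ec.
  have : (p %| gcdn `|numq b| `|denq b|)%N by rewrite dvdn_gcd pd andbT.
  by rewrite Ec Euclid_dvd1.
by rewrite Gauss_dvdzr // (negPf pD).
Qed.

Definition box_poly m H (g : {ffun 'I_m -> 'I_H}) : {poly int} :=
  \poly_(i < m) (if insub i is Some j then (g j : nat)%:Z else 0).

Lemma box_polyE m H (g : {ffun 'I_m -> 'I_H}) (i : 'I_m) :
  (box_poly g)`_i = (g i : nat)%:Z.
Proof. by rewrite coef_poly ltn_ord valK. Qed.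

Lemma box_poly_inj m H : injective (@box_poly m H).
Proof.
move=> g1 g2 Eg; apply/ffunP => i; apply: val_inj.
by have := congr1 (fun p : {poly int} => p`_i) Eg; rewrite !box_polyE => -[].
Qed.

Lemma box_polyB_bound m H (g1 g2 : {ffun 'I_m -> 'I_H}) :
  (size (box_poly g1 - box_poly g2)%R <= m)%N /\
  forall i, (`|((box_poly g1 - box_poly g2)`_i)%R| <= H)%N.
Proof.
split; first by rewrite (leq_trans (size_polyD _ _)) // size_polyN geq_max !size_poly.
move=> i; rewrite coefB; case: (ltnP i m) => im; last first.
  by rewrite !nth_default ?subr0 // (leq_trans (size_poly _ _)).
have := (box_polyE g1 (Ordinal im), box_polyE g2 (Ordinal im)) => /= -[-> ->].
move: (ltn_ord (g1 (Ordinal im))) (ltn_ord (g2 (Ordinal im))).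
move: (g1 _ : nat) (g2 _ : nat) => a b; clear; lia.
Qed.

(** Among the [T ^ N] polynomials with coefficients in [[0, T)], two have the same remainder by [E]
    modulo [l.+1]. Monicity of [E] allows division over the integers. *)
Lemma poly_pigeonhole (E : {poly int}) d l N T :
  E \is monic -> size E = d.+1 -> (l.+1 ^ d < T ^ N)%N ->
  exists P q W : {poly int}, [/\ P != 0, (size P <= N)%N,
     forall i, (`|(P`_i)%R| <= T)%N & P = q * E + l.+1%:Z *: W].
Proof.
move=> mE sE ltT.
pose rd P := Pdiv.Ring.rmodp P E.
pose h (g : {ffun 'I_N -> 'I_T}) : {ffun 'I_d -> 'I_l.+1} :=
  [ffun i : 'I_d => inord (absz ((rd (box_poly g))`_i %% l.+1%:Z)%Z)].
have /injectivePn [g1 [g2 g12 hg]] : ~~ injectiveb h.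
  apply/negP => /injectiveP /leq_card.
  by rewrite !card_ffun !card_ord leqNgt ltT.
pose P := box_poly g1 - box_poly g2; have [sP PT] := box_polyB_bound g1 g2.
have mod0 i : (l.+1%:Z %| (rd P)`_i)%Z.
  have sr G0 : (size (rd G0) <= d)%N.
    by rewrite -ltnS -sE Pdiv.Ring.ltn_rmodpN0 // monic_neq0.
  rewrite /rd /P Pdiv.RingMonic.rmodpB // coefB.
  case: (ltnP i d) => id; last first.
    by rewrite !nth_default ?subr0 ?dvdz0 // (leq_trans (sr _) id).
  have /(congr1 val) := congr1 (fun f : {ffun _} => f (Ordinal id)) hg.
  rewrite !ffunE /= !inordK; try by rewrite -ltz_nat gez0_abs ?modz_ge0 // ltz_pmod.
  move=> Eg; rewrite -eqz_mod_dvd; apply/eqP.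
  by have := congr1 Posz Eg; rewrite !gez0_abs ?modz_ge0.
have [W DW] : exists W, rd P = l.+1%:Z *: W.
  exists (map_poly (fun z => (z %/ l.+1%:Z)%Z) (rd P)); apply/polyP => i.
  by rewrite coefZ coef_map_id0 ?div0z // mulrC divzK.
exists P, (Pdiv.Ring.rdivp P E), W; split=> //.
  by rewrite subr_eq0; apply: contraNneq g12 => /box_poly_inj ->.
by rewrite -DW; apply: Pdiv.RingMonic.rdivp_eq.
Qed.

Lemma norm1_le (P : {poly int}) N T : (size P <= N)%N ->
  (forall i, `|(P`_i)%R| <= T)%N -> (norm1 P <= N * T)%N.
Proof.
move=> sP PT; apply: leq_trans (leq_mul sP (leqnn T)).
by rewrite -[X in (_ <= X * _)%N]card_ord -sum_nat_const; apply: leq_sum => i _.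
Qed.

(** By pigeonhole some small [P] is a multiple of [D] modulo [l.+1], so [l.+1 ^ d] divides the
    resultant of [D] and [P]. The Mahler bound on this resultant is smaller, hence it vanishes and
    [D] shares a root with [P]. *)
Lemma small_multiple (D : {poly int}) r d (V T : nat) :
  root_seq D r -> size D = d.+1 -> (0 < d)%N -> indecomposable D ->
  mahler D r <= V%:R -> (0 < V)%N -> (4 * d * V ^ 3 <= T)%N ->
  exists P : {poly int}, [/\ P != 0, (size P <= d.*2)%N,
    forall i, (`|(P`_i)%R| <= T)%N & pQ D %| pQ P].
Proof.
move=> Dr sD d0 irrD MV V0 leT.
have D0 : D != 0 by rewrite -size_poly_eq0 sD.
set c := `|lead_coef D|%N.
have c0 : (0 < c)%N by rewrite absz_gt0 lead_coef_eq0.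
have cV : (c <= V)%N.
  rewrite -(ler_nat algC) natr_absz intr_norm.
  exact: le_trans (mahler_ge_lead D r) MV.
(* [y ^ d] bounds the resultant of [D] and [P]; taking [l] a multiple of [c] makes [l.+1] prime to
   the leading coefficient of [D]. *)
pose y := (d.*2 * T * V ^ 2)%N; pose l := (c * y)%N.
have ly : (y <= l)%N by rewrite leq_pmull.
have T0 : (0 < T)%N by apply: leq_trans leT; rewrite !muln_gt0 ?d0 ?expn_gt0 ?V0.
have y0 : (0 < y)%N by rewrite !muln_gt0 ?double_gt0 ?d0 ?T0 ?expn_gt0 ?V0.
pose u : int := - sgz (lead_coef D) * y%:Z.
have ul : u * lead_coef D = - l%:Z.
  by rewrite /u mulrAC mulNr -abszEsg /l PoszM mulNr mulrC.
(* [E] is congruent to [u *: D] modulo [l.+1], and its leading coefficient is [- l + l.+1 = 1]. *)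
pose E := u *: D + l.+1%:Z *: 'X^d.
have sE' : (size E <= d.+1)%N.
  rewrite (leq_trans (size_polyD _ _)) // geq_max (leq_trans (size_scale_leq _ _)) ?sD //.
  by rewrite (leq_trans (size_scale_leq _ _)) ?size_polyXn.
have Ed : E`_d = 1.
  have -> : E`_d = u * lead_coef D + l.+1%:Z.
    by rewrite coefD !coefZ coefXn eqxx mulr1 lead_coefE sD.
  by rewrite ul intS; ring.
have sE : size E = d.+1.
  apply/eqP; rewrite eqn_leq sE' ltnNge; apply/negP => sEd.
  by move: Ed; rewrite nth_default.
have mE : E \is monic by rewrite monicE lead_coefE sE Ed.
have ltT : (l.+1 ^ d < T ^ d.*2)%N.
  rewrite -mul2n expnM ltn_exp2r // expnS expn1.
  have : (l <= V * y)%N by rewrite leq_mul2r cV orbT.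
  have : (T * (4 * d * V ^ 3) <= T * T)%N by rewrite leq_mul2l leT orbT.
  have -> : (T * (4 * d * V ^ 3) = 2 * (V * y))%N.
    by rewrite /y -mul2n !expnS expn0; ring.
  have : (0 < V * y)%N by rewrite muln_gt0 V0.
  lia.
have [P [q [W [P0 sP PT DP]]]] := poly_pigeonhole mE sE ltT.
exists P; split=> //.
pose W' := q * 'X^d + W.
have DP' : P = u *: q * D + l.+1%:Z *: W'.
  by rewrite DP /E /W' -!mul_polyC; ring.
pose e := maxn d.*2 (size W').
have se : (size P <= d.*2.+1)%N by rewrite leqW.
have [z1 [Dz1 _]] := resultant_int Dr D0 se.
have sW : (size W' <= e.+1)%N by rewrite leqW // leq_maxr.
have [z2 [Dz2 _]] := resultant_int Dr D0 sW.
have sr : size r = d by apply/eqP; rewrite -eqSS -(size_root_seq Dr) // sD.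
have rD a : a \in r -> root (pC D) a.
  by move=> ar; rewrite Dr rootZ ?root_prod_XsubC // intr_eq0 lead_coef_eq0.
have DPa a : (pC D).[a] = 0 -> (pC P).[a] = l.+1%:~R * (pC W').[a].
  move=> Da; rewrite DP' rmorphD rmorphM /= !map_polyZ /= hornerD hornerM Da.
  by rewrite mulr0 add0r hornerZ.
(* Both resultants are products over the roots of [D], where [P] equals [l.+1] times [W']; the power
   of the leading coefficient reconciles the formal degrees [d.*2] and [e]. *)
have E12 : lead_coef D ^+ (e - d.*2) * z1 = l.+1%:Z ^+ d * z2.
  apply: (@intr_inj algC); rewrite !rmorphM !rmorphXn /= Dz1 Dz2.
  rewrite mulrA -exprD subnK ?leq_maxl // mulrCA; congr (_ * _).
  rewrite -sr -[X in _ ^+ X * _]count_predT.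
  have -> : (l.+1%:~R) ^+ count predT r = \prod_(a <- r) l.+1%:~R :> algC.
    by rewrite big_const_seq -Monoid.iteropE.
  rewrite -big_split /= big_seq [RHS]big_seq; apply: eq_bigr => a /rD /rootP Da.
  exact: DPa.
have dvd1 : (l.+1%:Z ^+ d %| z1)%Z.
  have : (l.+1%:Z ^+ d %| lead_coef D ^+ (e - d.*2) * z1)%Z by rewrite E12 dvdz_mulr.
  rewrite Gauss_dvdzr //; apply: coprimezXl; apply: coprimezXr.
  rewrite coprimezE absz_nat -/c /coprime gcdnC /l -[(c * y).+1]addn1 mulnC.
  by rewrite gcdnMDl gcdn1.
have lt1 : (`|z1| < l.+1 ^ d)%N.
  rewrite -(ltr_nat algC) natr_absz intr_norm Dz1.
  apply: le_lt_trans (resultant_le Dr se) _; rewrite sr natrX.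
  apply: (@le_lt_trans _ _ (V%:R ^+ d.*2 * (d.*2 * T)%:R ^+ d)).
    apply: ler_pM; rewrite ?exprn_ge0 ?ler0n ?(le_trans ler01) ?mahler_ge1 //.
      by rewrite lerXn2r ?nnegrE ?ler0n // (le_trans ler01) ?mahler_ge1.
    by rewrite lerXn2r ?nnegrE ?ler0n // ler_nat norm1_le.
  rewrite -mul2n exprM -exprMn ltrXn2r -?lt0n // -natrX -natrM ?ler0n ?ltr_nat //.
  by rewrite ltnS mulnC mul2n -/y.
have z10 : z1 = 0.
  apply/eqP; rewrite -absz_eq0; apply: contraTT dvd1 => z1n.
  rewrite dvdzE abszX absz_nat; apply/negP => /dvdn_leq.
  by rewrite lt0n z1n leqNgt lt1 => /(_ isT).
move/eqP: Dz1; rewrite z10 eq_sym mulf_eq0 expf_eq0 intr_eq0 lead_coef_eq0 (negPf D0) andbF.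
rewrite prodf_seq_eq0 => /hasP[a ar /= Pa].
by apply: (@indecomposable_dvd D P a) => //; rewrite ?sD ?rD.
Qed.

(** * Landau's inequality and common roots *)

Definition norm2sq (N : nat) (P : {poly algC}) : algC := \sum_(i < N) `|P`_i| ^+ 2.

(* Moving a root z to the reflected point 1/z^* preserves the l2 norm of the
   coefficients. *)
Lemma norm2sq_flip N (P : {poly algC}) z : (size P < N)%N ->
  norm2sq N (P * ('X - z%:P)) = norm2sq N (P * (1 - z^* *: 'X)).
Proof.
case: N => // N; rewrite ltnS => sP; apply/eqP; rewrite -subr_eq0 /norm2sq -sumrB.
pose q i := if i is i'.+1 then `|P`_i'| ^+ 2 else 0.
rewrite (eq_bigr (fun i : 'I_N.+1 => (1 - `|z| ^+ 2) * (q i - q i.+1))).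
  rewrite -mulr_sumr -(big_mkord xpredT (fun i => q i - q i.+1)).
  rewrite (@telescope_sumr_eq _ 0 N.+1 (fun i => - q i)) //=.
    by rewrite nth_default // normr0 expr0n /= !oppr0 addr0 mulr0.
  by move=> i _; rewrite opprK addrC.
move=> i _; rewrite !mulrBr mulr1 !coefB !coefMC -scalerAr coefZ !coefMX.
case: i => -[|i] _ /=.
  rewrite mulr0 subr0 sub0r normrN normrM; ring.
rewrite !normCK !rmorphB !rmorphM /= conjCK; ring.
Qed.

(** A root outside the unit disc is reflected into it, and the leading coefficient absorbs the
    factor [max 1 |z|] of the Mahler measure. *)
Definition flip (z : algC) : {poly algC} :=
  if `|z| <= 1 then 'X - z%:P else 1 - z^* *: 'X.

Lemma size_flip z : size (flip z) = 2.
Proof.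
rewrite /flip; case: ifP => z1; first by rewrite size_XsubC.
have z0 : z^* != 0 by rewrite conjC_eq0; apply: contraFneq z1 => ->; rewrite normr0.
by rewrite addrC size_polyDl size_polyN size_scale ?size_polyX ?size_poly1.
Qed.

Lemma lead_coef_flip z : `|lead_coef (flip z)| = Num.max 1 `|z|.
Proof.
rewrite lead_coefE size_flip /flip; case: ifP => z1.
  rewrite coefB coefX coefC /= subr0 normr1.
  by rewrite /Order.max real_ltNge ?real1 ?normr_real // z1.
rewrite coefB coefZ coefX coef1 /= sub0r mulr1 normrN norm_conjC /Order.max.
by rewrite real_ltNge ?real1 ?normr_real // z1.
Qed.

Lemma norm2sq_prod_flip N (r : seq algC) (P : {poly algC}) :
  (size P + size r <= N)%N ->
  norm2sq N (P * \prod_(z <- r) ('X - z%:P)) = norm2sq N (P * \prod_(z <- r) flip z).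
Proof.
elim: r P => [|z r IH] P sN; first by rewrite !big_nil.
have sM (G : {poly algC}) : size G = 2 -> (size (P * G)%R + size r <= N)%N.
  move=> sG; apply: leq_trans sN; rewrite addnS -addSn leq_add2r.
  by rewrite (leq_trans (size_polyMleq _ _)) // sG addn2.
rewrite !big_cons !mulrA -IH; last by rewrite sM ?size_flip.
rewrite /flip; case: ifP => // z1.
rewrite -!mulrA ![_ * \prod_(_ <- r) _]mulrC !mulrA.
apply: norm2sq_flip; apply: leq_ltn_trans (size_polyMleq _ _) _.
by move: sN; rewrite size_prod_XsubC /=; lia.
Qed.

(** Reflecting the outer roots makes the leading coefficient as large as the Mahler measure while
    preserving the l2 norm, itself at most the l1 norm. *)
Lemma landau D r : root_seq D r -> mahler D r <= (norm1 D)%:R.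
Proof.
have [->|D0] := eqVneq D 0.
  by move=> _; rewrite /mahler lead_coef0 normr0 mul0r ler0n.
move=> Dr; set c : algC := (lead_coef D)%:~R.
have c0 : c != 0 by rewrite intr_eq0 lead_coef_eq0.
pose N := (size D).+1; have sr := size_root_seq Dr D0.
have E : norm2sq N (pC D) = norm2sq N (c *: \prod_(z <- r) flip z).
  rewrite Dr -/c -!mul_polyC norm2sq_prod_flip //.
  by rewrite size_polyC c0 /N sr.
have sfl : size (c *: \prod_(z <- r) flip z) = (size r).+1.
  rewrite size_scale //; elim: r {Dr sr E} => [|z r IH]; first by rewrite big_nil size_poly1.
  rewrite big_cons size_mul ?size_flip ?IH //= -size_poly_eq0 ?size_flip ?IH //.
have Dm : mahler D r = `|lead_coef (c *: \prod_(z <- r) flip z)|.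
  rewrite lead_coefZ lead_coef_prod normrM normr_prod /mahler; congr (_ * _).
  by apply: eq_bigr => z _; rewrite lead_coef_flip.
have m0 : 0 <= mahler D r by rewrite Dm.
rewrite -(@ler_pXn2r _ 2) ?nnegrE ?ler0n //.
apply: (@le_trans _ _ (norm2sq N (pC D))).
  rewrite E Dm lead_coefE sfl /=.
  have sN : (size r < N)%N by rewrite /N sr; lia.
  rewrite /norm2sq (bigD1 (Ordinal sN)) //= lerDl; apply: sumr_ge0 => i _; exact: exprn_ge0.
rewrite /norm2sq /N big_ord_recr /= nth_default; last first.
  by rewrite size_map_inj_poly //; exact: intr_inj.
rewrite normr0 expr0n addr0.
have -> : (norm1 D)%:R = \sum_(i < size D) `|(pC D)`_i|.
  rewrite /norm1 natr_sum; apply: eq_bigr => i _.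
  by rewrite coef_map /= natr_absz intr_norm.
rewrite [X in _ <= X]expr2 mulr_suml; apply: ler_sum => i _.
rewrite expr2 ler_wpM2l // (bigD1 i) //= lerDl sumr_ge0 //.
Qed.

Lemma prod_prime_pow_dvd (ps : seq nat) (k : nat -> nat) N :
  uniq ps -> all prime ps -> (forall p, p \in ps -> p ^ k p %| N)%N ->
  (\prod_(p <- ps) p ^ k p %| N)%N.
Proof.
elim: ps => [|p ps IH] /=; first by rewrite big_nil dvd1n.
move=> /andP[pps ups] /andP[pp aps] dv; rewrite big_cons Gauss_dvd.
  rewrite dv ?mem_head // IH // => q qs; apply: dv.
  by rewrite in_cons qs orbT.
rewrite big_seq; elim/big_ind: _ => [|x y cx cy|q qs]; first exact: coprimen1.
  by rewrite coprimeMr cx.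
rewrite coprimeXl // coprimeXr // prime_coprime // dvdn_prime2 // ?(allP aps) //.
by apply: contraNneq pps => ->.
Qed.

(** The residues to be discarded. By [small_multiple] they include the roots mod [p] of
    indecomposable factors of low degree and controlled Mahler measure. *)
Definition small_root (p m T : nat) : {set 'F_p} :=
  [set a | `[< exists P : {poly int}, [/\ P != 0, (size P <= m.*2)%N,
                 forall i, (`|(P`_i)%R| <= T)%N & (pF p P).[a] = 0] >]].

Definition common_root (p m T : nat) (D F : {poly int}) : {set 'F_p} :=
  [set a | [&& a \notin small_root p m T, (pF p D).[a] == 0 & (pF p F).[a] == 0]].

Lemma lead_coef_ndvd (D : {poly int}) r V p : root_seq D r -> D != 0 ->
  mahler D r <= V%:R -> (V < p)%N -> ~~ (p %| lead_coef D)%Z.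
Proof.
move=> Dr D0 MV Vp; rewrite dvdzE absz_nat gtnNdvd //.
  by rewrite absz_gt0 lead_coef_eq0.
apply: leq_ltn_trans Vp; rewrite -(ler_nat algC) natr_absz intr_norm.
exact: le_trans (mahler_ge_lead D r) MV.
Qed.

(** Strong induction on the size of [D]. For a product, the left side is submultiplicative and the
    right side multiplicative. A constant has no root since [p > V]. An indecomposable [D] of degree
    at most [m] has all its roots in [small_root]; one of larger degree cannot divide [F], so the
    resultant is nonzero and the whole product divides it. *)
Lemma prod_common_root (ps : seq nat) (m T V h : nat) (F D : {poly int}) :
  uniq ps -> all prime ps -> all (fun p => V < p)%N ps ->
  F != 0 -> (size F <= m)%N -> (norm1 F <= h)%N -> (0 < h)%N ->
  (0 < V)%N -> (4 * m * V ^ 3 <= T)%N ->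
  D != 0 -> (forall r, root_seq D r -> mahler D r <= V%:R) ->
  exists r, root_seq D r /\
    (\prod_(p <- ps) p ^ #|common_root p m T D F|)%N%:R
      <= mahler D r ^+ m * h%:R ^+ (size D).-1.
Proof.
move=> ups aps Vps F0 sF nF h0 V0 VT.
have [s] := ubnP (size D); elim: s D => // s IH D sD D0 MV.
have [r0 Dr0] := root_seq_exists D.
have rhs1 r : 1 <= mahler D r ^+ m * h%:R ^+ (size D).-1.
  by rewrite mulr_ege1 // exprn_ege1 ?mahler_ge1 // ler1n.
have ndvd p : p \in ps -> ~~ (p %| lead_coef D)%Z.
  by move=> pps; apply: lead_coef_ndvd (MV _ Dr0) (allP Vps _ pps).
have triv : (forall p, p \in ps -> common_root p m T D F = finset.set0) ->
    exists r, root_seq D r /\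
    (\prod_(p <- ps) p ^ #|common_root p m T D F|)%N%:R
      <= mahler D r ^+ m * h%:R ^+ (size D).-1.
  move=> C0; exists r0; split=> //; rewrite big_seq big1 // => p pps.
  by rewrite C0 // cards0.
have [sD1|sD1] := leqP (size D) 1.
  have lD : D`_0 = lead_coef D.
    by rewrite lead_coefE; case: (size D) sD1 => [|[]].
  apply: triv => p pps; apply/setP => a; rewrite !inE {1}(size1_polyC sD1) lD.
  rewrite map_polyC hornerC /= Fp_intr_eq0 ?(allP aps) // (negPf (ndvd _ pps)).
  by rewrite andbF.
have [irrD|] := pselect (indecomposable D); last first.
  move=> /existsNP[D1 /existsNP[D2 /not_implyP[DD /not_orP[]]]].
  move=> /negP; rewrite -ltnNge => s1 /negP; rewrite -ltnNge => s2.
  have D10 : D1 != 0 by rewrite -size_poly_gt0 ltnW.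
  have D20 : D2 != 0 by rewrite -size_poly_gt0 ltnW.
  have sDD : size D = (size D1 + size D2).-1 by rewrite DD size_mul.
  have ler1M (x y : algC) : 1 <= y -> 0 <= x -> x <= x * y.
    by move=> y1 x0; rewrite ler_peMr.
  have M0 (G : {poly int}) r : G != 0 -> 0 <= mahler G r.
    by move=> G0; rewrite (le_trans ler01) ?mahler_ge1.
  have [r2' Dr2'] := root_seq_exists D2.
  have [r1' Dr1'] := root_seq_exists D1.
  have [|||r1 [Dr1 le1]] := IH D1; rewrite ?sDD //.
  - by move: sD; rewrite sDD; lia.
  - move=> r Dr; apply: le_trans (MV (r ++ r2') _); last first.
      by rewrite DD; apply: root_seqM.
    by rewrite DD mahlerM ler1M ?M0 // mahler_ge1.
  have [|||r2 [Dr2 le2]] := IH D2; rewrite ?sDD //.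
  - by move: sD; rewrite sDD; lia.
  - move=> r Dr; apply: le_trans (MV (r1' ++ r) _); last first.
      by rewrite DD; apply: root_seqM.
    by rewrite DD mahlerM mulrC ler1M ?M0 // mahler_ge1.
  exists (r1 ++ r2); split; first by rewrite DD; apply: root_seqM.
  rewrite DD mahlerM.
  have -> : ((size D1 + size D2).-1.-1 = (size D1).-1 + (size D2).-1)%N by lia.
  rewrite exprMn exprD mulrACA; apply: le_trans (ler_pM _ _ le1 le2); rewrite ?ler0n //.
  rewrite -natrM ler_nat -big_split /= big_seq [X in (_ <= X)%N]big_seq.
  apply: leq_prod => p pps; rewrite -expnD leq_pexp2l ?prime_gt0 ?(allP aps) //.
  apply: leq_trans (subset_leq_card _) (leq_card_setU _ _).
  apply/fintype.subsetP => a; rewrite !inE rmorphM hornerM mulf_eq0.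
  by case/and3P => -> /orP[->|->] ->; rewrite ?orbT.
case Esz : (size D) sD1 => [//|d]; rewrite ltnS => d0.
have [dm|md] := leqP d m.
  have VTd : (4 * d * V ^ 3 <= T)%N.
    by apply: leq_trans VT; rewrite leq_mul2r leq_mul2l dm !orbT.
  have [P [P0 sP PT DP]] := small_multiple Dr0 Esz d0 irrD (MV _ Dr0) V0 VTd.
  rewrite -Esz; apply: triv => p pps; apply/setP => a; rewrite !inE.
  apply/negbTE/negP => /and3P[/negP nE /eqP Da _]; apply: nE.
  apply/asboolP; exists P; split=> //; first by rewrite (leq_trans sP) // leq_double.
  exact: rat_dvd_root_mod (allP aps _ pps) (ndvd _ pps) DP Da.
have sF' : (size F <= m.+1)%N by rewrite leqW.
have [z [Dz dvz]] := resultant_int Dr0 D0 sF'.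
have sr : size r0 = d by apply/eqP; rewrite -eqSS -(size_root_seq Dr0 D0) Esz.
exists r0; split=> //=.
have z0 : z != 0.
  apply/eqP => z0; move/esym/eqP: Dz; rewrite z0 mulf_eq0 expf_eq0 intr_eq0.
  rewrite lead_coef_eq0 (negPf D0) andbF /= prodf_seq_eq0 => /hasP[a ar /= Fa].
  have /dvdp_leq : pQ D %| pQ F.
    apply: (@indecomposable_dvd D F a) => //; first by rewrite Esz.
    by rewrite Dr0 rootZ ?root_prod_XsubC // intr_eq0 lead_coef_eq0.
  rewrite !size_map_inj_poly //; try exact: intr_inj.
  rewrite -size_poly_eq0 size_map_inj_poly //; try exact: intr_inj.
  rewrite size_poly_eq0 => /(_ F0); rewrite Esz leqNgt; case/negP.
  by rewrite ltnS (leq_trans sF) // ltnW.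
have dv : (\prod_(p <- ps) p ^ #|common_root p m T D F| %| `|z|)%N.
  apply: (@prod_prime_pow_dvd ps (fun p => #|common_root p m T D F|)) => // p pps.
  have pp := allP aps _ pps.
  rewrite -[X in (X %| _)%N]absz_nat -dvdzE; apply: dvz => //; last first.
    by move=> a; rewrite inE => /and3P[_ /eqP-> /eqP->].
  (* There are at most [d] common roots, because the leading coefficient of [D] is nonzero mod
     [p]. *)
  rewrite sr (@leq_trans d) ?leq_addr //.
  have pD0 : pF p D != 0.
    apply/eqP => /(congr1 (fun G : {poly 'F_p} => G`_d)); rewrite coef_map coef0 /=.
    move/eqP; rewrite Fp_intr_eq0 //; apply/negP; have := ndvd _ pps.
    by rewrite lead_coefE Esz.
  rewrite -ltnS cardE; apply: leq_trans (max_poly_roots pD0 _ (enum_uniq _)) _.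
    apply/allP => a; rewrite mem_enum inE => /and3P[_ Da _]; exact: Da.
  by rewrite -Esz size_poly.
apply: (@le_trans _ _ (`|z|%N%:R)).
  by rewrite ler_nat dvdn_leq // absz_gt0.
rewrite natr_absz intr_norm Dz; apply: le_trans (resultant_le Dr0 sF') _.
rewrite sr ler_wpM2l ?exprn_ge0 ?(le_trans ler01) ?mahler_ge1 //.
by rewrite lerXn2r ?nnegrE ?ler0n // ler_nat.
Qed.

(** * Counting roots on average over primes *)

(** Cauchy-Schwarz applied to the sizes of the fibres of [f]. *)
Lemma card_collisions (I J : finType) (f : I -> J) :
  (#|I| ^ 2 <= #|J| * #|[set u : I * I | f u.1 == f u.2]|)%N.
Proof.
pose c y := #|[set x | f x == y]|.
have cI : (#|I| = \sum_y c y)%N.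
  rewrite -sum1_card (partition_big f xpredT) //=; apply: eq_bigr => y _.
  by rewrite /c -sum1_card; apply: eq_bigl => x; rewrite inE.
have cII : (#|[set u : I * I | f u.1 == f u.2]| = \sum_y c y ^ 2)%N.
  rewrite -sum1_card (partition_big (fun u => f u.1) xpredT) //=.
  apply: eq_bigr => y _; rewrite expnS expn1 -cardsX -sum1_card.
  apply: eq_bigl => -[u v]; rewrite !inE /=.
  by case: (f u =P y) => [->|]; rewrite ?andbF ?andbT //= eq_sym.
rewrite cII cI -(leq_pmul2l (isT : 0 < 2)%N).
apply: (@leq_trans (\sum_y \sum_z (c y ^ 2 + c z ^ 2))).
  rewrite expnS expn1 big_distrl /= big_distrr /=; apply: leq_sum => y _.
  rewrite big_distrr /= big_distrr /=; apply: leq_sum => z _.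
  by have [] := nat_Cauchy (c y) (c z).
apply/eq_leq; under eq_bigr do rewrite big_split /= sum_nat_const.
by rewrite big_split /= -big_distrr /= sum_nat_const mul2n addnn.
Qed.

Definition root_set (p m T : nat) (D : {poly int}) : {set 'F_p} :=
  [set a | (a \notin small_root p m T) && ((pF p D).[a] == 0)].

Section Average.
Variable R : realType.

Lemma ln_natr_ge0 n : 0 <= ln (n%:R : R).
Proof. by case: n => [|n]; [rewrite ln0 | rewrite ln_ge0 // ler1n]. Qed.

Lemma ln_prodn (s : seq nat) (k : nat -> nat) :
  (forall p, p \in s -> 0 < p)%N ->
  ln (\prod_(p <- s) p ^ k p)%N%:R = \sum_(p <- s) (k p)%:R * ln p%:R :> R.
Proof.
elim: s => [|p s IH] s0; first by rewrite !big_nil ln1.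
have s0' q : q \in s -> (0 < q)%N by move=> qs; apply: s0; rewrite in_cons qs orbT.
have p0 : (0 < p)%N by rewrite s0 ?mem_head.
have P0 : (0 < \prod_(q <- s) q ^ k q)%N.
  by rewrite big_seq prodn_cond_gt0 // => q /s0' q0; rewrite expn_gt0 q0.
rewrite !big_cons natrM natrX lnM ?posrE ?exprn_gt0 ?ltr0n //.
by rewrite lnXn ?ltr0n // IH // mulr_natl.
Qed.

(** Double counting of the roots [a] of [D] against pairs of box polynomials that agree at [a]: each
    root has many pairs by [card_collisions], each pair has few roots by [prod_common_root]. *)
Lemma root_set_average (ps : seq nat) (m n T V H : nat) (D : {poly int}) :
  uniq ps -> all prime ps -> all (fun p => V < p)%N ps ->
  (0 < m)%N -> (0 < V)%N -> (4 * m * V ^ 3 <= T)%N ->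
  all (fun p => 2 * p <= H ^ m)%N ps ->
  D != 0 -> (size D <= n.+1)%N -> (norm1 D <= V)%N ->
  \sum_(p <- ps) ln p%:R / p%:R * #|root_set p m T D|%:R
     <= 2 * (m%:R * ln V%:R + n%:R * ln (m * H)%:R) :> R.
Proof.
move=> ups aps Vps m0 V0 VT Hps D0 sD nD.
have [->|psn] := eqVneq ps [::].
  rewrite big_nil mulr_ge0 // addr_ge0 // mulr_ge0 ?ler0n //; last exact: ln_natr_ge0.
  exact: ln_natr_ge0.
have H0 : (0 < H)%N.
  case: ps ups aps Vps Hps psn => // p ps _ /andP[pp _] _ /andP[+ _] _.
  case: H => //; rewrite exp0n // leqn0 muln_eq0 /= => /eqP p0.
  by rewrite p0 in pp.
have h0 : (0 < m * H)%N by rewrite muln_gt0 m0.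
set L : R := m%:R * ln V%:R + n%:R * ln (m * H)%:R.
pose N := (H ^ m)%N.
have N0 : (0 < N)%N by rewrite expn_gt0 H0.
pose B := {ffun 'I_m -> 'I_H}.
have cB : #|{: B}| = N by rewrite card_ffun !card_ord.
pose F (u : B * B) := box_poly u.1 - box_poly u.2.
have logF (u : B * B) : u.1 != u.2 ->
    \sum_(p <- ps) #|common_root p m T D (F u)|%:R * ln p%:R <= L.
  move=> u12; have [sF FH] := box_polyB_bound u.1 u.2.
  have F0 : F u != 0.
    by rewrite subr_eq0; apply: contraNneq u12 => /box_poly_inj ->.
  have MV r : root_seq D r -> mahler D r <= V%:R.
    by move=> /landau /le_trans; apply; rewrite ler_nat.
  have [r [Dr]] := prod_common_root ups aps Vps F0 sF (norm1_le sF FH) h0 V0 VT D0 MV.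
  move=> lep; pose P := (\prod_(p <- ps) p ^ #|common_root p m T D (F u)|)%N.
  have P_le : (P <= V ^ m * (m * H) ^ n)%N.
    rewrite -(ler_nat algC); apply: le_trans lep _.
    rewrite [X in _ <= X]natrM !natrX; apply: ler_pM;
      rewrite ?exprn_ge0 ?ler0n ?(le_trans ler01) ?mahler_ge1 //.
      by rewrite lerXn2r ?nnegrE ?ler0n ?MV // (le_trans ler01) ?mahler_ge1.
    by rewrite ler_weXn2l ?ler1n // -ltnS (leq_trans _ sD) // prednK // size_poly_gt0.
  have ps0 p : p \in ps -> (0 < p)%N by move=> pps; rewrite prime_gt0 // (allP aps).
  rewrite -(ln_prodn _ ps0) -/P; apply: (@le_trans _ _ (ln (V ^ m * (m * H) ^ n)%N%:R)).
    rewrite ler_ln ?posrE ?ltr0n ?ler_nat ?muln_gt0 ?expn_gt0 ?V0 ?h0 //.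
    by rewrite /P big_seq prodn_cond_gt0 // => p /ps0 p0; rewrite expn_gt0 p0.
  rewrite natrM !natrX lnM ?posrE ?exprn_gt0 ?ltr0n //.
  by rewrite !lnXn ?ltr0n // /L !mulr_natl.
have L0 : 0 <= L by rewrite addr_ge0 // mulr_ge0 ?ler0n // ln_natr_ge0.
(* At a fixed [a], at least [N ^ 2 / p] pairs collide. The diagonal accounts for [N] of them, at
   most half of this number since [2 * p <= N]. *)
have cnt p : p \in ps -> (#|root_set p m T D| * N ^ 2 <=
    2 * p * \sum_(u : B * B | u.1 != u.2) #|common_root p m T D (F u)|)%N.
  move=> pps; have pp := allP aps _ pps.
  pose Fz a (u : B * B) := (pF p (F u)).[a] == 0.
  have -> : (\sum_(u : B * B | u.1 != u.2) #|common_root p m T D (F u)| =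
      \sum_(a in root_set p m T D) #|[set u : B * B | (u.1 != u.2) && Fz a u]|)%N.
    rewrite (eq_bigr (fun u => \sum_(a in common_root p m T D (F u)) 1)%N); last first.
      by move=> u _; rewrite sum1_card.
    rewrite [RHS](eq_bigr (fun a => \sum_(u : B * B | (u.1 != u.2) && Fz a u) 1)%N); last first.
      by move=> a _; rewrite -sum1_card; apply: eq_bigl => u; rewrite inE.
    rewrite (exchange_big_dep (mem (root_set p m T D))) /=; last first.
      by move=> u a _; rewrite !inE => /and3P[-> -> _].
    apply: eq_bigr => a; rewrite inE => /andP[aE Da]; apply: eq_bigl => u.
    by rewrite inE aE Da /Fz.
  rewrite big_distrr /= -sum_nat_const; apply: leq_sum => a _.
  set off := #|_|.
  pose f (g : B) := (pF p (box_poly g)).[a].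
  have := card_collisions f; rewrite cB card_Fp //.
  set col := #|_| => colN.
  have colE : (col <= N + off)%N.
    rewrite -cB -(cardsT B) -(card_imset [set: B]%SET (f := fun g : B => (g, g)));
      last by move=> x y [].
    apply: leq_trans (leq_card_setU _ _); apply: subset_leq_card.
    apply/fintype.subsetP => -[g1 g2]; rewrite !inE /Fz /F /= rmorphB /=.
    rewrite hornerD hornerN subr_eq0 => E12.
    have [->|g12] := eqVneq g1 g2; last by rewrite E12 orbT.
    by rewrite imset_f ?inE.
  have : (2 * p <= N)%N := allP Hps _ pps.
  have : (p * col <= p * (N + off))%N by rewrite leq_mul2l colE orbT.
  have : (2 * p * N <= N * N)%N -> (N ^ 2 <= p * col)%N -> (p * col <= p * (N + off))%N ->
    (N ^ 2 <= 2 * p * off)%N by clear; nia.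
  move=> H1 H2 H3; apply: H1 => //; by rewrite leq_mul2r H3 orbT.
have N2 : (0 < N ^ 2)%N by rewrite -mulnn muln_gt0 N0.
rewrite -(@ler_pM2r _ ((N ^ 2)%N%:R)) ?ltr0n //.
apply: (@le_trans _ _ (\sum_(p <- ps) \sum_(u : B * B | u.1 != u.2)
    2 * (#|common_root p m T D (F u)|%:R * ln p%:R))).
  rewrite mulr_suml big_seq [X in _ <= X]big_seq; apply: ler_sum => p pps.
  have p0 : 0 < (p%:R : R) by rewrite ltr0n prime_gt0 // (allP aps).
  rewrite -mulr_sumr -mulr_suml -natr_sum -[X in X <= _]mulrA -natrM.
  have := cnt p pps; rewrite -(ler_nat R) => {}cnt.
  rewrite mulrAC ler_pdivrMr //; apply: le_trans (ler_wpM2l (ln_natr_ge0 _) cnt) _.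
  by rewrite le_eqVlt; apply/orP; left; apply/eqP; rewrite natrM (natrM _ 2 p); ring.
rewrite exchange_big /=.
apply: (@le_trans _ _ (\sum_(u : B * B | u.1 != u.2) 2 * L)).
  by apply: ler_sum => u u12; rewrite -mulr_sumr ler_wpM2l // logF.
rewrite sumr_const -[X in X <= _]mulr_natr ler_wpM2l ?mulr_ge0 // ler_nat.
by rewrite (leq_trans (max_card _)) // card_prod cB expnS expn1.
Qed.

End Average.

(** * Convolutions with dilated measures *)

Lemma card_root_le p N (G : {poly int}) : prime p -> (size G <= N)%N -> pF p G != 0 ->
  (#|[set a : 'F_p | ((pF p G).[a] == 0)%R]%SET| <= N)%N.
Proof.
move=> pp sG G0; rewrite ltnW // cardE.
apply: leq_trans (max_poly_roots G0 _ (enum_uniq _)) _.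
  by apply/allP => a; rewrite mem_enum inE.
by rewrite (leq_trans (size_poly _ _)).
Qed.

Lemma pF_neq0 p T (P : {poly int}) : prime p -> (T < p)%N -> P != 0 ->
  (forall i, (`|(P`_i)%R| <= T)%N) -> pF p P != 0.
Proof.
move=> pp Tp P0 PT; apply/eqP => /(congr1 (fun G : {poly 'F_p} => G`_(size P).-1)).
rewrite coef_map coef0 /= -lead_coefE => /eqP; rewrite Fp_intr_eq0 // dvdzE absz_nat.
apply/negP; rewrite gtnNdvd ?absz_gt0 ?lead_coef_eq0 //.
by rewrite (leq_ltn_trans _ Tp) // lead_coefE PT.
Qed.

(** There are [(2 * T).+1 ^ m.*2] candidate polynomials, and [T < p] keeps the nonzero ones nonzero
    mod [p]. *)
Lemma card_small_root p m T : prime p -> (T < p)%N ->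
  (#|small_root p m T| <= (2 * T).+1 ^ m.*2 * m.*2)%N.
Proof.
move=> pp Tp; pose B := {ffun 'I_m.*2 -> 'I_(2 * T).+1}.
pose G (g : B) : {poly int} :=
  \poly_(i < m.*2) (if insub i is Some j then (g j : nat)%:Z - T%:Z else 0).
pose S (g : B) := if pF p (G g) == 0 then finset.set0 else
  [set a : 'F_p | (pF p (G g)).[a] == 0]%SET.
have sub : small_root p m T \subset \bigcup_(g : B) S g.
  apply/fintype.subsetP => a; rewrite inE => /asboolP[P [P0 sP PT Pa]].
  pose g : B := [ffun i : 'I_m.*2 => inord (absz (P`_i + T%:Z))].
  have GP : G g = P.
    apply/polyP => i; rewrite coef_poly; case: ltnP => im; last first.
      by rewrite nth_default // (leq_trans sP).
    rewrite insubT /= ffunE inordK /=.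
      by move: (PT i); move: (P`_i) => z; clear; lia.
    by move: (PT i); move: (P`_i) => z; clear; lia.
  apply/finset.bigcupP; exists g => //; rewrite /S GP (negPf (pF_neq0 pp Tp P0 PT)).
  by rewrite inE Pa.
apply: leq_trans (subset_leq_card sub) _.
have -> : ((2 * T).+1 ^ m.*2 = #|{: B}|)%N by rewrite card_ffun !card_ord.
have leU : (#|\bigcup_(g : B) S g| <= \sum_(g : B) #|S g|)%N.
  elim/big_rec2: _ => [|g x y _ IH]; first by rewrite cards0.
  by apply: leq_trans (leq_card_setU _ _) _; rewrite leq_add2l.
rewrite -sum_nat_const; apply: leq_trans leU _.
apply: leq_sum => g _; rewrite /S; case: ifP => [_|/negbT G0]; first by rewrite cards0.
by apply: card_root_le => //; rewrite size_poly.
Qed.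

(** ['X] and all ['X^k - 1] with [0 < k < m.*2] are among the polynomials that define
    [small_root]. *)
Lemma expr_inj_notin p m T (a : 'F_p) : prime p -> (0 < m)%N -> (0 < T)%N ->
  a \notin small_root p m T ->
  a != 0 /\ forall i j, (i < m)%N -> (j < m)%N -> a ^+ i = a ^+ j -> i = j.
Proof.
move=> pp m0 T0; rewrite inE => /asboolPn aN.
have N1 k : (0 < k < m.*2)%N -> a ^+ k != 1.
  move=> /andP[k0 km]; apply/eqP => ak; apply: aN; exists ('X^k - 1); split.
  - by rewrite -size_poly_gt0 size_XnsubC.
  - by rewrite size_XnsubC.
  - move=> i; rewrite coefB coefXn coef1; apply: leq_trans T0.
    by case: (i =P k) => [->|_]; case: eqP => // k00; rewrite k00 in k0.
  - by rewrite rmorphB /= map_polyXn rmorph1 !hornerE ak subrr.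
have a0 : a != 0.
  apply/eqP => a0; apply: aN; exists 'X; split.
  - by rewrite polyX_eq0.
  - by rewrite size_polyX; lia.
  - by move=> i; rewrite coefX; case: eqP => //; rewrite T0.
  - by rewrite map_polyX hornerX.
split=> //.
suff H i j : (i < j)%N -> (j < m)%N -> a ^+ i = a ^+ j -> False.
  move=> i j im jm E; case: (ltngtP i j) => // ij; last by case: (H _ _ ij im (esym E)).
  by case: (H _ _ ij jm E).
move=> ij jm E; have /eqP := N1 (j - i)%N ltac:(apply/andP; split; lia); apply.
apply: (mulfI (expf_neq0 i a0)).
by rewrite -exprD subnKC ?mulr1 // ltnW.
Qed.

Section L2.
Variables (R : realType) (p : nat).
Hypothesis pp : prime p.
Implicit Types (nu pi h : 'F_p -> R) (c a : 'F_p).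

(** For probability laws, this is the law of [c * Y + Z] with [Y], [Z] independent of laws [nu] and
    [h]. *)
Definition cconv c nu h (x : 'F_p) : R := \sum_y nu y * h (x - c * y).

Definition sqnorm h : R := \sum_x h x ^+ 2.

Lemma sqnorm_shift h t : \sum_x h (x - t) ^+ 2 = sqnorm h.
Proof.
rewrite /sqnorm (reindex (fun x : 'F_p => x + t)); last first.
  by exists (fun x => x - t) => x _; rewrite ?addrK ?subrK.
by apply: eq_bigr => x _; rewrite addrK.
Qed.

Lemma cconv_comm c c' nu pi h x :
  cconv c nu (cconv c' pi h) x = cconv c' pi (cconv c nu h) x.
Proof.
rewrite /cconv; under eq_bigr do rewrite mulr_sumr.
rewrite exchange_big; apply: eq_bigr => y _ /=; rewrite mulr_sumr.
by apply: eq_bigr => z _; rewrite mulrCA addrAC.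
Qed.

Lemma cconv_comp c c' nu pi h x :
  cconv c (cconv c' nu pi) h x = cconv (c * c') nu (cconv c pi h) x.
Proof.
rewrite /cconv; under eq_bigr do rewrite mulr_suml.
rewrite exchange_big; apply: eq_bigr => y _ /=; rewrite mulr_sumr.
rewrite (reindex (fun x : 'F_p => x + c' * y)); last first.
  by exists (fun x => x - c' * y) => z _; rewrite ?addrK ?subrK.
apply: eq_bigr => z _; rewrite addrK mulrA mulrDr mulrA.
by rewrite [c * z + _]addrC opprD addrA.
Qed.

(** Jensen's inequality at each [x], the defect being a variance; translations preserve the norm. *)
Lemma sqnorm_cconv_le c nu h : (forall y, 0 <= nu y) -> \sum_y nu y = 1 ->
  sqnorm (cconv c nu h) <= sqnorm h.
Proof.
move=> nu0 nu1.
have jensen x : cconv c nu h x ^+ 2 <= \sum_y nu y * h (x - c * y) ^+ 2.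
  set M := cconv c nu h x; rewrite -subr_ge0.
  have -> : \sum_y nu y * h (x - c * y) ^+ 2 - M ^+ 2 =
            \sum_y nu y * (h (x - c * y) - M) ^+ 2.
    rewrite [RHS](eq_bigr (fun y => nu y * h (x - c * y) ^+ 2 +
        ((- 2 * M) * (nu y * h (x - c * y)) + M ^+ 2 * nu y))); last first.
      by move=> y _; ring.
    rewrite !big_split /= -!mulr_sumr nu1 -/(cconv c nu h x) -/M; ring.
  by apply: sumr_ge0 => y _; rewrite mulr_ge0 // sqr_ge0.
apply: le_trans (ler_sum _ (fun x _ => jensen x)) _.
rewrite exchange_big /=; under eq_bigr do rewrite -mulr_sumr sqnorm_shift.
by rewrite -mulr_suml nu1 mul1r.
Qed.

(** Expand the square over pairs [y], [z]. When [y != z], the point [x + c * (y - z)] runs over the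
    whole field with [c], so the mean-zero [h] kills the term; only the diagonal survives. *)
Lemma sum_sqnorm_cconv nu h : \sum_x h x = 0 ->
  \sum_c sqnorm (cconv c nu h) = p%:R * sqnorm nu * sqnorm h.
Proof.
move=> h0.
have E c x : cconv c nu h x ^+ 2 =
    \sum_y \sum_z nu y * nu z * (h (x - c * y) * h (x - c * z)).
  rewrite expr2 /cconv mulr_suml; apply: eq_bigr => y _.
  by rewrite mulr_sumr; apply: eq_bigr => z _; rewrite mulrACA.
rewrite /sqnorm; under eq_bigr do under eq_bigr do rewrite E.
have -> : \sum_c \sum_x \sum_y \sum_z nu y * nu z * (h (x - c * y) * h (x - c * z)) =
   \sum_y \sum_z nu y * nu z * \sum_c \sum_x (h (x - c * y) * h (x - c * z)).
  under eq_bigr do rewrite exchange_big /=.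
  rewrite exchange_big /=; apply: eq_bigr => y _.
  under eq_bigr do rewrite exchange_big /=.
  rewrite exchange_big /=; apply: eq_bigr => z _.
  by rewrite mulr_sumr; apply: eq_bigr => c _; rewrite mulr_sumr.
rewrite -/(sqnorm h) mulr_sumr mulr_suml; apply: eq_bigr => y _.
rewrite (bigD1 y) //= [X in _ + X]big1 ?addr0 => [|z zy].
  have -> : \sum_c \sum_x h (x - c * y) * h (x - c * y) = p%:R * sqnorm h.
    under eq_bigr => c _.
      under eq_bigr do rewrite -expr2.
      rewrite sqnorm_shift.
      over.
    by rewrite sumr_const card_Fp // mulr_natl.
  by rewrite /sqnorm; ring.
rewrite exchange_big /=;
have -> : \sum_x \sum_c h (x - c * y) * h (x - c * z) =
    \sum_c \sum_x h x * h (x + c * (y - z)).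
  rewrite exchange_big /=; apply: eq_bigr => c _.
  rewrite (reindex (fun x : 'F_p => x + c * y)); last first.
    by exists (fun x => x - c * y) => w _; rewrite ?addrK ?subrK.
  by apply: eq_bigr => x _; rewrite addrK; congr (_ * h _); ring.
rewrite exchange_big /= [X in _ * X]big1 ?mulr0 // => x _.
rewrite -mulr_sumr (_ : \sum_c _ = 0) ?mulr0 // -[RHS]h0.
have yz : y - z != 0 by rewrite subr_eq0 eq_sym.
rewrite [RHS](reindex (fun c : 'F_p => x + c * (y - z))) //.
exists (fun w => (w - x) / (y - z)) => w _; first by rewrite addrC addKr mulfK.
by rewrite divfK // addrC subrK.
Qed.

End L2.

(** * The law of the chain *)

Section Law.
Variables (R : realType) (p : nat) (mu : {fsfun int -> R with 0}).
Hypothesis pp : prime p.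
Hypothesis mu_prob : is_probability mu.
Implicit Types (a x : 'F_p).

Lemma mu_ge0 z : 0 <= mu z. Proof. by case: mu_prob. Qed.

Lemma mu_sum1 : \sum_(z : finsupp mu) mu (val z) = 1.
Proof. by case: mu_prob => _ <-; rewrite big_seq_fsetE. Qed.

Lemma foldl_chain a (s : seq int) x :
  foldl (fun x z => a * x + z%:~R) x s = a ^+ size s * x + chain a s.
Proof.
rewrite /chain; elim: s x => [|z s IH] x /=; first by rewrite mul1r addr0.
rewrite IH [in RHS]IH exprS mulr0 add0r; ring.
Qed.

Lemma chain_cons a z (s : seq int) : chain a (z :: s) = a ^+ size s * z%:~R + chain a s.
Proof. by rewrite {1}/chain /= mulr0 add0r foldl_chain. Qed.

Lemma law0 a x : law mu a 0 x = (x == 0)%:R.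
Proof.
rewrite /law (eq_bigl (fun b : 0.-tuple (finsupp mu) => x == 0)); last first.
  by move=> b; rewrite tuple0 /chain /= eq_sym.
case: eqP => _; last by rewrite big_pred0.
rewrite (big_pred1 [tuple]) ?big_nil // => b; by rewrite [b]tuple0 /= eqxx.
Qed.

Lemma sum_tupleS (T : finType) n (F : n.+1.-tuple T -> R) :
  \sum_b F b = \sum_z \sum_(t : n.-tuple T) F [tuple of z :: t].
Proof.
rewrite pair_big /=.
rewrite (reindex (fun u : T * n.-tuple T => [tuple of u.1 :: u.2])) //.
exists (fun b => (thead b, [tuple of behead b])) => [[z t] _|b _] /=.
  by congr pair; apply: val_inj.
by rewrite [RHS]tuple_eta.
Qed.

(** The recursion conditions on the first increment, which reaches the final position multiplied by
    [a ^+ n]. *)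
Lemma lawS a n x :
  law mu a n.+1 x = \sum_(z : finsupp mu) mu (val z) * law mu a n (x - a ^+ n * (val z)%:~R).
Proof.
rewrite {1}/law big_mkcond sum_tupleS; apply: eq_bigr => z _.
rewrite /law mulr_sumr [RHS]big_mkcond; apply: eq_bigr => t _ /=.
have eqE (w c y : 'F_p) : (w + c == y) = (c == y - w).
  by rewrite [RHS]eq_sym subr_eq [RHS]eq_sym addrC.
by rewrite chain_cons size_map size_tuple big_cons eqE.
Qed.

Lemma law_ge0 a n x : 0 <= law mu a n x.
Proof. by apply: sumr_ge0 => b _; apply: prodr_ge0 => z _; apply: mu_ge0. Qed.

Lemma sum_law a n : \sum_x law mu a n x = 1.
Proof.
elim: n => [|n IH].
  by under eq_bigr do rewrite law0; rewrite (bigD1 0) //= big1 ?addr0 ?eqxx // => x /negPf->.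
under eq_bigr do rewrite lawS; rewrite exchange_big /= -[RHS]mu_sum1.
apply: eq_bigr => z _; rewrite -mulr_sumr -[RHS]mulr1 -IH; congr (_ * _).
rewrite (reindex (fun x : 'F_p => x + a ^+ n * (val z)%:~R)) /=; last first.
  by exists (fun x => x - a ^+ n * (val z)%:~R) => w _; rewrite ?addrK ?subrK.
by apply: eq_bigr => x _; rewrite addrK.
Qed.

(** The position after [n + k] steps is [a ^+ k] times the one after [n] steps plus an independent
    [k]-step position. *)
Lemma lawD a n k x : law mu a (n + k) x = cconv (a ^+ k) (law mu a n) (law mu a k) x.
Proof.
rewrite /cconv; elim: n x => [|n IH] x.
  rewrite (bigD1 0) //= big1 => [|y /negPf y0]; last by rewrite law0 y0 mul0r.
  by rewrite law0 eqxx mul1r mulr0 subr0 addr0.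
rewrite addSn lawS; under eq_bigr do rewrite IH mulr_sumr.
under [RHS]eq_bigr do rewrite lawS mulr_suml.
rewrite [RHS]exchange_big /=; apply: eq_bigr => z _.
rewrite [RHS](reindex (fun x : 'F_p => x + a ^+ n * (val z)%:~R)) /=; last first.
  by exists (fun x => x - a ^+ n * (val z)%:~R) => w _; rewrite ?addrK ?subrK.
apply: eq_bigr => y _; rewrite addrK mulrA; congr (_ * law mu a k _).
by rewrite exprD; ring.
Qed.

Definition centered a n x : R := law mu a n x - uniform_law R x.

Lemma sum_uniform : \sum_(x : 'F_p) uniform_law R x = 1.
Proof.
rewrite sumr_const card_Fp // -[_ *+ _]mulr_natl /uniform_law mulfV //.
by rewrite pnatr_eq0 -lt0n prime_gt0.
Qed.

Lemma centeredD a n k x :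
  centered a (n + k) x = cconv (a ^+ k) (law mu a n) (centered a k) x.
Proof.
rewrite /centered lawD /cconv; under [RHS]eq_bigr do rewrite mulrBr.
rewrite sumrB; congr (_ - _); rewrite -mulr_suml sum_law mul1r //.
Qed.

Lemma sum_centered a n : \sum_x centered a n x = 0.
Proof. by rewrite /centered sumrB sum_law sum_uniform subrr. Qed.

Lemma sqnorm_centered a n :
  p%:R * sqnorm (centered a n) = p%:R * sqnorm (law mu a n) - 1.
Proof.
have p0 : p%:R != 0 :> R by rewrite pnatr_eq0 -lt0n prime_gt0.
rewrite /sqnorm (eq_bigr (fun x => law mu a n x ^+ 2 +
   ((- 2 / p%:R) * law mu a n x + p%:R^-1 * uniform_law R x))); last first.
  by move=> x _; rewrite /centered /uniform_law; ring.
rewrite !big_split /= -!mulr_sumr sum_law sum_uniform.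
by field.
Qed.

(** Each of the [m] dilations [a ^+ (n + j)] gives an upper bound for the same norm; together these
    bounds are at most the sum over all dilations, known from [sum_sqnorm_cconv]. *)
Lemma sqnorm_centered_le a n m : (m <= n)%N -> (0 < m)%N -> a != 0 ->
  (forall i j, (i < m)%N -> (j < m)%N -> a ^+ i = a ^+ j -> i = j) ->
  p%:R * sqnorm (centered a (3 * n)) <= (p%:R * sqnorm (law mu a n)) ^+ 2 / m%:R.
Proof.
move=> mn m0 a0 inj; have p0 : 0 < (p%:R : R) by rewrite ltr0n prime_gt0.
set nu := law mu a n; set h := centered a n.
have le_j (j : 'I_m) : sqnorm (centered a (3 * n)) <= sqnorm (cconv (a ^+ (n + j)) nu h).
  have jn : (j <= n)%N by rewrite ltnW // (leq_trans (ltn_ord j)).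
  (* Split the increments into consecutive blocks of lengths [n - j], [n], [j], [n]. The second is
     dilated by [a ^+ (n + j)]; the first and third cannot increase the norm. *)
  have -> : sqnorm (centered a (3 * n)) =
     sqnorm (cconv (a ^+ n) (law mu a j)
        (cconv (a ^+ (n + j) * a ^+ n) (law mu a (n - j)) (cconv (a ^+ (n + j)) nu h))).
    apply: eq_bigr => x _; congr (_ ^+ 2).
    have -> : (3 * n = (n - j + n + j) + n)%N by lia.
    rewrite centeredD -/h.
    have -> : law mu a (n - j + n + j) = cconv (a ^+ j) (law mu a (n - j + n)) (law mu a j).
      by apply/funext => y; rewrite lawD.
    rewrite cconv_comp cconv_comm -exprD.
    rewrite /cconv; apply: eq_bigr => y _; congr (_ * _).
    rewrite -/(cconv _ _ _ _) -/(cconv (a ^+ (n + j)) nu h _).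
    have -> : law mu a (n - j + n) = cconv (a ^+ n) (law mu a (n - j)) nu.
      by apply/funext => w; rewrite lawD.
    by rewrite cconv_comp.
  apply: le_trans (sqnorm_cconv_le _ _ (law_ge0 a j) (sum_law a j)) _.
  exact: sqnorm_cconv_le (law_ge0 _ _) (sum_law _ _).
have sum_le : m%:R * sqnorm (centered a (3 * n)) <= p%:R * sqnorm nu * sqnorm h.
  rewrite -(sum_sqnorm_cconv pp nu (sum_centered a n)).
  rewrite mulr_natl -[m in X in X <= _]card_ord -sumr_const.
  apply: le_trans (ler_sum _ (fun j _ => le_j j)) _.
  have inj' : injective (fun j : 'I_m => a ^+ (n + j)).
    move=> i j; rewrite !exprD => /(mulfI (expf_neq0 n a0)) E.
    by apply: val_inj; apply: inj (ltn_ord i) (ltn_ord j) E.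
  rewrite -(big_imset (fun c => sqnorm (cconv c nu h))
    (h := fun j : 'I_m => a ^+ (n + j)) (A := xpredT)); last first.
    by move=> i j _ _; apply: inj'.
  rewrite [X in _ <= X](bigID (mem ((fun j : 'I_m => a ^+ (n + j)) @: xpredT)%SET)) /=.
  by rewrite lerDl sumr_ge0 // => c _; apply: sumr_ge0 => x _; apply: sqr_ge0.
rewrite ler_pdivlMr ?ltr0n // -mulrA [_ * m%:R]mulrC.
apply: le_trans (ler_wpM2l (ltW p0) sum_le) _.
have nu0 : 0 <= sqnorm nu by apply: sumr_ge0 => x _; apply: sqr_ge0.
rewrite mulrCA expr2; apply: ler_wpM2l; first by rewrite mulr_ge0 // ltW.
by rewrite sqnorm_centered; lra.
Qed.

End Law.

(** * Mixing times and pairs of polynomials *)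

Section Mixing.
Variables (R : realType) (p : nat) (mu : {fsfun int -> R with 0}).
Hypothesis pp : prime p.

(** Cauchy-Schwarz: the distance is at most the l1 norm, whose square is at most [p] times the
    squared l2 norm. *)
Lemma tv_dist_le (f g : 'F_p -> R) (delta : R) : 0 <= delta ->
  p%:R * l2norm_sq (fun x => f x - g x) <= delta ^+ 2 -> tv_dist f g <= delta.
Proof.
move=> d0 le2; apply: ge_sup.
  by exists `|\sum_(x in finset.set0) f x - \sum_(x in finset.set0) g x|; exists finset.set0.
move=> _ [A _ <-]; rewrite -sumrB; pose h x := `|f x - g x|.
apply: (@le_trans _ _ (\sum_x h x)).
  apply: le_trans (ler_norm_sum _ _ _) _; rewrite big_mkcond; apply: ler_sum => x _.
  by case: ifP => // _; rewrite /h.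
have S0 : 0 <= \sum_x h x by apply: sumr_ge0 => x _; apply: normr_ge0.
rewrite -(@ler_pXn2r _ 2) ?nnegrE //; apply: le_trans le2.
have -> : l2norm_sq (fun x => f x - g x) = \sum_x h x ^+ 2 by [].
have p0 : 0 < (p%:R : R) by rewrite ltr0n prime_gt0.
set S := \sum_x h x.
have : 0 <= \sum_x (p%:R * h x - S) ^+ 2 by apply: sumr_ge0 => x _; apply: sqr_ge0.
rewrite (eq_bigr (fun x => p%:R ^+ 2 * h x ^+ 2 + ((- 2 * p%:R * S) * h x + S ^+ 2))); last first.
  by move=> x _; ring.
rewrite !big_split /= sumr_const card_Fp // -!mulr_sumr -/S -[S ^+ 2 *+ _]mulr_natr.
move: (\sum_i h i ^+ 2) => Q.
have -> : p%:R ^+ 2 * Q + (- 2 * p%:R * S * S + S ^+ 2 * p%:R) = p%:R * (p%:R * Q - S ^+ 2) by ring.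
by rewrite pmulr_rge0 // subr_ge0.
Qed.

Lemma Tmix_le_T2mix (a : 'F_p) (delta : R) : 0 <= delta ->
  (Tmix mu a delta <= T2mix mu a delta)%E.
Proof.
move=> d0; apply: ereal_inf_le_tmp => _ [n /= H <-]; exists n => //=.
exact: tv_dist_le.
Qed.

Lemma T2mix_le (a : 'F_p) (delta : R) n :
  p%:R * sqnorm (centered mu a n) <= delta ^+ 2 -> (T2mix mu a delta <= n%:R%:E)%E.
Proof.
move=> H; apply: ereal_inf_lbound; exists n => //=; apply: le_trans H.
rewrite le_eqVlt; apply/orP; left; apply/eqP; congr (_ * _).
by apply: eq_bigr => x _; rewrite real_normK ?num_real.
Qed.

End Mixing.

Section Pairs.
Variables (R : realType) (mu : {fsfun int -> R with 0}).
Hypothesis mu_prob : is_probability mu.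
Notation S := (finsupp mu).

(** Reversed because the chain is a Horner scheme: the first increment goes with the highest power
    of [a]. *)
Definition bpoly (b : seq int) : {poly int} := Poly (rev b).

Lemma chain_bpoly p (a : 'F_p) b : chain a b = (pF p (bpoly b)).[a].
Proof.
rewrite /bpoly map_Poly_id0 // horner_Poly /chain -{1}(revK b) foldl_rev.
by elim: (rev b) => //= z s ->; rewrite mulrC.
Qed.

Definition vals n (b : n.-tuple S) : seq int := [seq val z | z <- b].

(** [Poly] drops leading zeros, but the common length [n] restores them. *)
Lemma bpoly_inj n (b b' : n.-tuple S) : bpoly (vals b) = bpoly (vals b') -> b = b'.
Proof.
move=> E; apply: val_inj; apply: (inj_map val_inj); apply: (can_inj revK).
apply: (@eq_from_nth _ 0); first by rewrite !size_rev !size_map !size_tuple.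
by move=> i _; have := congr1 (fun P : {poly int} => P`_i) E; rewrite !coef_Poly.
Qed.

(* The extra [1] only ensures positivity. *)
Definition supp_bound : nat := (2 * \sum_(z <- S) `|z|)%N.+1.

Lemma supp_bound_gt0 : (0 < supp_bound)%N. Proof. by []. Qed.

Lemma size_bpolyB n (b b' : n.-tuple S) :
  (size (bpoly (vals b) - bpoly (vals b'))%R <= n)%N.
Proof.
have sb (c : n.-tuple S) : (size (bpoly (vals c)) <= n)%N.
  by rewrite (leq_trans (size_Poly _)) // size_rev size_map size_tuple.
by rewrite (leq_trans (size_polyD _ _)) // size_polyN geq_max !sb.
Qed.

Lemma norm1_bpolyB n (b b' : n.-tuple S) :
  (norm1 (bpoly (vals b) - bpoly (vals b'))%R <= n * supp_bound)%N.
Proof.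
apply: norm1_le; first exact: size_bpolyB.
move=> i; rewrite coefB !coef_Poly.
have bd (c : n.-tuple S) : (`|nth 0%R (rev (vals c)) i| <= \sum_(z <- S) `|z|)%N.
  have [ic|ic] := ltnP i (size (rev (vals c))); last by rewrite nth_default.
  have /mapP[z _ ->] : nth 0 (rev (vals c)) i \in vals c by rewrite -mem_rev mem_nth.
  by rewrite (big_rem (val z)) ?leq_addr //=; apply: valP.
move: (bd b) (bd b'); rewrite /supp_bound.
move: (nth _ (rev (vals b)) i) (nth _ (rev (vals b')) i) (\sum_(z <- S) `|z|)%N => x y s.
by clear; lia.
Qed.

Definition weight n (b : n.-tuple S) : R := \prod_(z <- b) mu (val z).

Lemma weight_ge0 n (b : n.-tuple S) : 0 <= weight b.
Proof. by apply: prodr_ge0 => z _; apply: mu_ge0. Qed.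

Lemma sum_weightX n k : \sum_(b : n.-tuple S) weight b ^+ k = (\sum_(z <- S) mu z ^+ k) ^+ n.
Proof.
elim: n => [|n IH].
  rewrite (big_pred1 [tuple]) ?/weight ?big_nil ?expr1n // => b.
  by rewrite [b]tuple0 /= eqxx.
rewrite sum_tupleS exprS -IH big_seq_fsetE mulr_suml; apply: eq_bigr => z _ /=.
by rewrite mulr_sumr; apply: eq_bigr => t _; rewrite /weight big_cons exprMn.
Qed.

Lemma sum_weight n : \sum_(b : n.-tuple S) weight b = 1.
Proof.
have := sum_weightX n 1; rewrite (eq_bigr (@weight n)) => [->|//].
by rewrite (eq_bigr mu) // mu_prob.2 expr1n.
Qed.

(** An expected number of roots for the difference of two independent random polynomials, restricted
    to the event that they differ. *)
Definition pair_roots p n m T : R :=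
  \sum_(u : n.-tuple S * n.-tuple S | u.1 != u.2)
    weight u.1 * weight u.2 * #|root_set p m T (bpoly (vals u.1) - bpoly (vals u.2))|%:R.

(** The squared norm of the law is the probability that two independent chains meet, that is, that
    [a] is a root of the difference. Equal tuples meet for every [a] and produce the second term. *)
Lemma sum_sqnorm_law p n m T : prime p ->
  \sum_(a : 'F_p | a \notin small_root p m T) sqnorm (law mu a n)
    <= pair_roots p n m T + p%:R * (\sum_(z <- S) mu z ^+ 2) ^+ n.
Proof.
move=> pp.
pose w (u : n.-tuple S * n.-tuple S) := weight u.1 * weight u.2.
have sqE a : sqnorm (law mu a n) =
    \sum_u w u *+ ((pF p (bpoly (vals u.1) - bpoly (vals u.2))).[a] == 0).
  rewrite -(pair_bigA _ (fun b b' => w (b, b') *+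
    ((pF p (bpoly (vals b) - bpoly (vals b'))).[a] == 0))) /=.
  rewrite /sqnorm (eq_bigr (fun x => \sum_(b : n.-tuple S | chain a (vals b) == x)
      \sum_(b' : n.-tuple S | chain a (vals b') == x) w (b, b'))); last first.
    by move=> x _; rewrite expr2 /law big_distrl; apply: eq_bigr => b _; rewrite big_distrr.
  rewrite (exchange_big_dep xpredT) //=; apply: eq_bigr => b _.
  rewrite (big_pred1 (chain a (vals b))) => [|x]; last by rewrite eq_sym.
  rewrite big_mkcond; apply: eq_bigr => b' _ /=.
  rewrite rmorphB /= hornerD hornerN subr_eq0 -!chain_bpoly [_ == chain a (vals b)]eq_sym.
  by case: eqP.
under eq_bigr do rewrite sqE.
rewrite exchange_big /= (bigID (fun u => u.1 != u.2)) /= lerD //.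
  rewrite le_eqVlt; apply/orP; left; apply/eqP; apply: eq_bigr => u _.
  rewrite -/(w u) mulr_natr -sumr_const; rewrite [RHS]big_mkcond [LHS]big_mkcond /=.
  by apply: eq_bigr => a _; rewrite [a \in root_set _ _ _ _]inE; case: ifP => //= _; case: ifP.
apply: (@le_trans _ _ (\sum_(b : n.-tuple S) p%:R * weight b ^+ 2)).
  rewrite (eq_bigl (fun u => u.1 == u.2)); last by move=> u; rewrite negbK.
  rewrite (reindex (fun b : n.-tuple S => (b, b))) /=; last first.
    by exists fst => [//|[b b']]; rewrite inE /= => /eqP ->.
  rewrite (eq_bigl xpredT) => [|b]; last exact: eqxx.
  apply: ler_sum => b _; rewrite subrr rmorph0 /w /= -expr2 mulr_natl.
  under eq_bigr do rewrite horner0 eqxx mulr1n.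
  by rewrite sumr_const ler_wpMn2l ?sqr_ge0 // -[X in (_ <= X)%N](card_Fp pp) max_card.
by rewrite -mulr_sumr sum_weightX.
Qed.

Lemma pair_roots_average (ps : seq nat) (n m T H : nat) :
  uniq ps -> all prime ps -> all (fun p => n * supp_bound < p)%N ps ->
  (0 < m)%N -> (0 < n)%N -> (4 * m * (n * supp_bound) ^ 3 <= T)%N ->
  all (fun p => 2 * p <= H ^ m)%N ps ->
  \sum_(p <- ps) ln p%:R / p%:R * pair_roots p n m T
     <= 2 * (m%:R * ln (n * supp_bound)%:R + n%:R * ln (m * H)%:R).
Proof.
move=> ups aps Vps m0 n0 VT Hps; set L := _ * (_ + _).
have V0 : (0 < n * supp_bound)%N by rewrite muln_gt0 n0.
under eq_bigr do rewrite /pair_roots mulr_sumr.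
rewrite exchange_big /=.
have L0 : 0 <= L by rewrite mulr_ge0 // addr_ge0 // mulr_ge0 ?ler0n // ln_natr_ge0.
apply: (@le_trans _ _ (\sum_(u : n.-tuple S * n.-tuple S | u.1 != u.2)
    weight u.1 * weight u.2 * L)).
  apply: ler_sum => u u12.
  under eq_bigr do rewrite mulrCA.
  rewrite -mulr_sumr ler_wpM2l ?mulr_ge0 ?weight_ge0 //.
  apply: root_set_average => //.
  - by rewrite subr_eq0; apply: contraNneq u12 => /bpoly_inj ->.
  - by rewrite leqW // size_bpolyB.
  - exact: norm1_bpolyB.
rewrite -mulr_suml -[X in _ <= X]mul1r ler_wpM2r //.
apply: (@le_trans _ _ (\sum_(u : n.-tuple S * n.-tuple S) weight u.1 * weight u.2)).
  rewrite [X in _ <= X](bigID (fun u => u.1 != u.2)) /= lerDl sumr_ge0 // => u _.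
  by rewrite mulr_ge0 ?weight_ge0.
rewrite -(pair_bigA _ (fun b b' => weight b * weight b')) /=.
under eq_bigr do rewrite -mulr_sumr sum_weight mulr1.
by rewrite sum_weight.
Qed.

End Pairs.

(** * Choice of parameters *)

Section Scales.
Local Open Scope classical_set_scope.
Variable R : realType.

(** With [u = ln Y / k.+1], [Y] is the power [k.+1] of [expR u >= u]. *)
Lemma near_ln_pow (C : R) (k : nat) : \forall Y \near +oo, C * ln Y ^+ k <= Y.
Proof.
near=> Y.
have l0 : Num.max 0 (C * k.+1%:R ^+ k.+1) <= ln Y.
  rewrite -ler_expR lnK; last by rewrite posrE; near: Y; exact: nbhs_pinfty_gt.
  by near: Y; apply: nbhs_pinfty_ge; rewrite num_real.
have Y0 : 0 < Y by near: Y; exact: nbhs_pinfty_gt.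
move: l0; rewrite ge_max => /andP[L0 LC].
set L := ln Y in L0 LC *.
have DY : Y = expR (L / k.+1%:R) ^+ k.+1.
  by rewrite -expRM_natl mulrC divfK // lnK.
rewrite {}DY; apply: (@le_trans _ _ ((L / k.+1%:R) ^+ k.+1)).
  rewrite expr_div_n ler_pdivlMr ?exprn_gt0 // mulrAC [L ^+ k.+1]exprS.
  by rewrite ler_wpM2r ?exprn_ge0.
rewrite lerXn2r ?nnegrE ?divr_ge0 ?expR_ge0 //.
by apply: le_trans (expR_ge1Dx _); rewrite lerDr.
Unshelve. all: by end_near.
Qed.

Lemma near_ln_ge (C : R) : \forall Y \near +oo, C <= ln Y.
Proof.
near=> Y.
rewrite -ler_expR lnK; last by rewrite posrE; near: Y; exact: nbhs_pinfty_gt.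
by near: Y; apply: nbhs_pinfty_ge; rewrite num_real.
Unshelve. all: by end_near.
Qed.

Variables (h : R) (C0 : nat).
Hypothesis h0 : 0 < h.
Hypothesis C00 : (0 < C0)%N.

(* [72] keeps the number of small-coefficient polynomials below [expR (Y / 2)] and
   [288 = 4 * 72] makes [scale_H Y ^ scale_m Y] exceed [expR (2 * Y)]. *)
Definition scale_n (Y : R) := Num.truncn (Y / h).
Definition scale_m (Y : R) := Num.truncn (Y / (72 * ln Y)).
Definition scale_T (Y : R) := (4 * scale_m Y * (scale_n Y * C0) ^ 3)%N.
Definition scale_H (Y : R) := ((Num.truncn Y).+1 ^ 288)%N.
(** The constant of [scale_cost]: [577 = 1 + 2 * 288], since [scale_m Y <= Y] and
    [scale_H Y <= Y ^+ (2 * 288)]. *)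
Definition scale_A : R := 4 + 2 * 577 / h.

Lemma scale_A_gt0 : 0 < scale_A.
Proof. by have hV : 0 < h^-1 by [rewrite invr_gt0]; rewrite /scale_A; lra. Qed.

Definition scale_ok (Y : R) :=
  [/\ 4 <= Y, C0%:R / h <= Y, 1 <= ln Y, h / 72 <= ln Y & 144 * ln Y <= Y].

Lemma near_scale_ok : \forall Y \near +oo, scale_ok Y.
Proof.
near=> Y; split; try by near: Y; apply: nbhs_pinfty_ge; rewrite num_real.
- by near: Y; exact: near_ln_ge.
- by near: Y; exact: near_ln_ge.
- by rewrite -[ln Y]expr1; near: Y; exact: near_ln_pow.
Unshelve. all: by end_near.
Qed.

Variable Y : R.
Hypothesis okY : scale_ok Y.
Let Y4 : 4 <= Y. Proof. by case: okY. Qed.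
Let YC : C0%:R / h <= Y. Proof. by case: okY. Qed.
Let L1 : 1 <= ln Y. Proof. by case: okY. Qed.
Let Lh : h / 72 <= ln Y. Proof. by case: okY. Qed.
Let YL : 144 * ln Y <= Y. Proof. by case: okY. Qed.
Let Y0 : 0 < Y. Proof. by apply: lt_le_trans Y4. Qed.
Let L0 : 0 < ln Y. Proof. by apply: lt_le_trans L1. Qed.
Let YE : Y = expR (ln Y). Proof. by rewrite lnK. Qed.

Ltac scale_hyps := have ? := Y4; have ? := L1; have ? := YL; have ? := Y0; have ? := L0.
Ltac slra := scale_hyps; lra.
Ltac snra := scale_hyps; nra.

Lemma scale_n_le : (scale_n Y)%:R <= Y / h.
Proof. by rewrite truncn_le divr_ge0 ?ltW. Qed.

Lemma scale_m_le : (scale_m Y)%:R <= Y / (72 * ln Y).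
Proof. by rewrite truncn_le divr_ge0 ?mulr_ge0 ?ltW. Qed.

Lemma scale_m_ge : Y / (144 * ln Y) <= (scale_m Y)%:R.
Proof.
have Q0 : 0 <= Y / (72 * ln Y) by rewrite divr_ge0 ?mulr_ge0 ?ltW.
have /andP[_] := truncn_itv Q0; rewrite -/(scale_m Y) -[(scale_m Y).+1%:R]natr1.
have d0 : 0 < 144 * ln Y by slra.
have : 1 <= Y / (144 * ln Y) by rewrite ler_pdivlMr ?mul1r.
have -> : Y / (72 * ln Y) = Y / (144 * ln Y) * 2 by field; rewrite gt_eqF.
slra.
Qed.

Lemma scale_m_gt0 : (0 < scale_m Y)%N.
Proof.
rewrite -(ltr_nat R); apply: lt_le_trans scale_m_ge.
by have d0 : 0 < 144 * ln Y by [slra]; rewrite divr_gt0.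
Qed.

Lemma scale_m_le_n : (scale_m Y <= scale_n Y)%N.
Proof.
apply: le_truncn; rewrite ler_pM2l // lef_pV2 ?posrE ?mulr_gt0 //.
by rewrite -ler_pdivrMl // mulrC.
Qed.

Lemma scale_n_gt0 : (0 < scale_n Y)%N.
Proof. exact: leq_trans scale_m_gt0 scale_m_le_n. Qed.

Lemma scale_V_le : (scale_n Y * C0)%:R <= Y ^+ 2.
Proof.
rewrite natrM; apply: le_trans (ler_wpM2r (ler0n _ _) scale_n_le) _.
by rewrite mulrAC -mulrA expr2 ler_wpM2l // ltW.
Qed.

Lemma scale_m_leY : (scale_m Y)%:R <= Y.
Proof.
apply: le_trans scale_m_le _; rewrite ler_pdivrMr ?mulr_gt0 //.
by apply: ler_peMr; [exact: ltW | slra].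
Qed.

Lemma scale_T_le : (scale_T Y)%:R <= Y ^+ 8.
Proof.
rewrite /scale_T natrM [X in X * _]natrM natrX.
have -> : Y ^+ 8 = Y * Y * (Y ^+ 2) ^+ 3 by ring.
apply: ler_pM; rewrite ?mulr_ge0 ?exprn_ge0 ?ler0n //.
  by apply: ler_pM; rewrite ?ler0n ?scale_m_leY.
by rewrite lerXn2r ?nnegrE ?ler0n ?exprn_ge0 ?(ltW Y0) ?scale_V_le.
Qed.

Lemma scale_T_gt0 : (0 < scale_T Y)%N.
Proof.
have V0 : (0 < scale_n Y * C0)%N by rewrite muln_gt0 scale_n_gt0.
by rewrite /scale_T muln_gt0 muln_gt0 scale_m_gt0 expn_gt0 V0.
Qed.

Lemma scale_T_lt p : 2 / 3 * Y < ln p%:R -> (0 < p)%N -> (scale_T Y < p)%N.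
Proof.
move=> Yp p0; rewrite -(ltr_nat R); apply: le_lt_trans scale_T_le _.
rewrite -ltr_ln ?posrE ?exprn_gt0 ?ltr0n // lnXn // -[_ *+ 8]mulr_natl.
by apply: le_lt_trans Yp; slra.
Qed.

Lemma scale_V_lt p : 2 / 3 * Y < ln p%:R -> (0 < p)%N -> (scale_n Y * C0 < p)%N.
Proof.
move=> Yp p0; apply: leq_ltn_trans (scale_T_lt Yp p0).
have V0 : (0 < scale_n Y * C0)%N by rewrite muln_gt0 scale_n_gt0.
rewrite /scale_T expnS mulnCA leq_pmulr //.
by rewrite muln_gt0 muln_gt0 scale_m_gt0 expn_gt0 V0.
Qed.

Lemma scale_H_ge p : ln p%:R <= Y -> (0 < p)%N -> (2 * p <= scale_H Y ^ scale_m Y)%N.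
Proof.
move=> pY p0; rewrite -(ler_nat R) /scale_H -expnM natrX natrM.
have /andP[_ tY] := truncn_itv (ltW Y0).
apply: (@le_trans _ _ (Y ^+ (288 * scale_m Y))); last first.
  by rewrite lerXn2r ?nnegrE ?ler0n ?ltW.
have -> : Y ^+ (288 * scale_m Y) = expR ((288 * scale_m Y)%:R * ln Y).
  by rewrite expRM_natl lnK.
apply: (@le_trans _ _ (expR (Y + Y))).
  rewrite expRD; apply: ler_pM => //; first by apply: le_trans (expR_ge1Dx _); slra.
  by rewrite -[p%:R]lnK ?posrE ?ltr0n // ler_expR.
rewrite ler_expR natrM -mulrA.
have := scale_m_ge; rewrite ler_pdivrMr ?mulr_gt0 //.
by move: (_%:R) => m; slra.
Qed.

Lemma scale_cost : 2 * ((scale_m Y)%:R * ln (scale_n Y * C0)%:R +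
    (scale_n Y)%:R * ln (scale_m Y * scale_H Y)%:R) <= scale_A * Y * ln Y.
Proof.
have V0 : (0 < scale_n Y * C0)%N by rewrite muln_gt0 scale_n_gt0.
have lnV : ln (scale_n Y * C0)%:R <= 2 * ln Y.
  rewrite mulr_natl -lnXn // ler_ln ?posrE ?exprn_gt0 ?ltr0n //; exact: scale_V_le.
have tY : (Num.truncn Y).+1%:R <= Y ^+ 2.
  have : (Num.truncn Y)%:R <= Y by rewrite truncn_le ltW.
  by rewrite -[(Num.truncn Y).+1%:R]natr1 expr2 => tY; snra.
have lnH : ln (scale_m Y * scale_H Y)%:R <= 577 * ln Y.
  rewrite /scale_H natrM natrX lnM ?posrE ?exprn_gt0 ?ltr0n ?scale_m_gt0 //.
  rewrite lnXn ?ltr0n // -[_ *+ 288]mulr_natl.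
  have l1 : ln (scale_m Y)%:R <= ln Y by rewrite ler_ln ?posrE ?ltr0n ?scale_m_gt0 ?scale_m_leY.
  have l2 : ln (Num.truncn Y).+1%:R <= 2 * ln Y.
    by rewrite mulr_natl -lnXn // ler_ln ?posrE ?exprn_gt0 ?ltr0n.
  by slra.
have e1 : (scale_m Y)%:R * ln (scale_n Y * C0)%:R <= 2 * Y * ln Y.
  apply: le_trans (ler_wpM2l (ler0n _ _) lnV) _.
  by have := ler_wpM2r (ltW L0) scale_m_leY; slra.
have e2 : (scale_n Y)%:R * ln (scale_m Y * scale_H Y)%:R <= Y / h * (577 * ln Y).
  apply: le_trans (ler_wpM2l (ler0n _ _) lnH) _.
  have e3 : 0 <= 577 * ln Y by slra.
  exact: ler_wpM2r e3 _ _ scale_n_le.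
have -> : scale_A * Y * ln Y = 2 * (2 * Y * ln Y + Y / h * (577 * ln Y)).
  by rewrite /scale_A; field; rewrite gt_eqF.
by rewrite ler_wpM2l // lerD.
Qed.

(** Each factor is at most [expR (Y / 4)]: the first has exponent at most [18 * m * ln Y], where
    [m <= Y / (72 * ln Y)]. *)
Lemma scale_small_roots :
  (((2 * scale_T Y).+1 ^ (scale_m Y).*2 * (scale_m Y).*2)%N)%:R <= expR (Y / 2).
Proof.
have -> : Y / 2 = Y / 4 + Y / 4 by field.
rewrite expRD natrM natrX; apply: ler_pM; rewrite ?exprn_ge0 ?ler0n //.
  apply: (@le_trans _ _ ((Y ^+ 9) ^+ (scale_m Y).*2)).
    rewrite lerXn2r ?nnegrE ?ler0n ?exprn_ge0 ?(ltW Y0) // -natr1 natrM exprS.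
    have T1 : 1 <= (scale_T Y)%:R :> R by rewrite ler1n scale_T_gt0.
    have := scale_T_le; move: (Y ^+ 8) => Z ZT; snra.
  have -> : (Y ^+ 9) ^+ (scale_m Y).*2 = expR ((9 * (scale_m Y).*2)%:R * ln Y).
    by rewrite expRM_natl lnK // exprM.
  rewrite ler_expR -mul2n !natrM.
  have := scale_m_le; rewrite ler_pdivlMr ?mulr_gt0 //.
  by move: (_%:R) => m; slra.
apply: (@le_trans _ _ (Y ^+ 2)).
  by rewrite -mul2n natrM expr2 ler_pM // ?scale_m_leY //; slra.
rewrite -[Y ^+ 2]lnK ?posrE ?exprn_gt0 // ler_expR lnXn // -[_ *+ 2]mulr_natl; slra.
Qed.

End Scales.

(** * The exceptional primes *)

Section Main.
Local Open Scope classical_set_scope.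
Variables (R : realType) (mu : {fsfun int -> R with 0}).
Hypotheses (mu_prob : is_probability mu) (mu_supp : (2 <= #|` finsupp mu|)%N).
Notation S := (finsupp mu).
Notation s := (\sum_(z <- S) mu z ^+ 2).
Notation h := (H2 mu).
Notation C0 := (supp_bound mu).

Lemma mu_gt0 z : z \in S -> 0 < mu z.
Proof. by rewrite mem_finsupp lt_def => ->; exact: mu_ge0. Qed.

(** A second point of the support has positive mass; this strictness makes [H2 mu] positive. *)
Lemma mu_lt1 z : z \in S -> mu z < 1.
Proof.
move=> zS; have [_ <-] := mu_prob.
have /fset0Pn[y] : (S `\ z != fset0)%fset.
  rewrite -cardfs_gt0.
  by move: mu_supp; rewrite (cardfsD1 z) zS add1n ltnS.
rewrite !inE => /andP[yz yS].
rewrite (big_fsetD1 z) //= ltrDl (big_fsetD1 y) ?inE ?yz //=.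
by rewrite ltr_wpDr ?mu_gt0 // big_seq sumr_ge0 // => w _; apply: mu_ge0.
Qed.

Lemma finsupp_neq0 : exists z, z \in S.
Proof. by apply/fset0Pn; rewrite -cardfs_gt0 (ltn_trans _ mu_supp). Qed.

Lemma sum_sqr_gt0 : 0 < s.
Proof.
have [z zS] := finsupp_neq0.
rewrite (big_fsetD1 z) //= ltr_wpDr ?exprn_gt0 ?mu_gt0 //.
by apply: sumr_ge0 => w _; apply: sqr_ge0.
Qed.

Lemma sum_sqr_lt1 : s < 1.
Proof.
have [z zS] := finsupp_neq0; have [_ <-] := mu_prob.
have le y : y \in S -> mu y ^+ 2 <= mu y.
  by move=> yS; rewrite expr2 ler_piMr ?mu_ge0 // ltW // mu_lt1.
rewrite (big_fsetD1 z) //= [X in _ < X](big_fsetD1 z) //= ltr_leD //.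
  by rewrite expr2 gtr_pMr ?mu_gt0 ?mu_lt1.
rewrite big_seq [X in _ <= X]big_seq; apply: ler_sum => y.
by rewrite !inE => /andP[_ yS]; exact: le.
Qed.

Lemma H2_gt0 : 0 < h.
Proof. by rewrite /H2 oppr_gt0 ln_lt0 // sum_sqr_gt0 sum_sqr_lt1. Qed.

Lemma sum_sqrE : s = expR (- h).
Proof. by rewrite /H2 opprK lnK // posrE sum_sqr_gt0. Qed.


(** A balance: its square over [scale_m Y] is at most of order [1 / ln Y ^+ 3], which tends to 0,
    while the primes exceeding it have reciprocal sum of order at most [ln Y ^+ 3 / sqrt Y]. *)
Definition threshold (Y : R) := Num.sqrt Y / ln Y ^+ 2.
Definition scale_roots (Y : R) p := pair_roots mu p (scale_n h Y) (scale_m Y) (scale_T h C0 Y).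
(** The ratio [3 / 2] is small enough: [3 * scale_n h Y] is at most [9 / 2 * ln p / h], within
    [5 / h * ln p]. *)
Definition in_scale (Y : R) p := prime p /\ 2 / 3 * Y < ln (p%:R : R) <= Y.

(** Markov's inequality for [pair_roots_average], with [ln p] bounded below by [2 / 3 * Y]. *)
Lemma exceptional_sum Y (ps : seq nat) : scale_ok h C0 Y -> uniq ps ->
  (forall p, p \in ps -> in_scale Y p /\ threshold Y < scale_roots Y p) ->
  \sum_(p <- ps) p%:R^-1 <= 3 / 2 * scale_A h * ln Y ^+ 3 / Num.sqrt Y.
Proof.
move=> okY ups psP; have [Y4 _ L1 _ _] := okY.
have h0 := H2_gt0.
have Y0 : 0 < Y by apply: lt_le_trans Y4.
have L0 : 0 < ln Y by apply: lt_le_trans L1.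
have sY : 0 < Num.sqrt Y by rewrite sqrtr_gt0.
have pp p : p \in ps -> prime p by move=> /psP[[]].
have p0 p : p \in ps -> (0 < p)%N by move=> /pp/prime_gt0.
have avg : \sum_(p <- ps) ln p%:R / p%:R * scale_roots Y p <= scale_A h * Y * ln Y.
  apply: le_trans (scale_cost h0 (supp_bound_gt0 mu) okY).
  apply: pair_roots_average => //.
  - by apply/allP.
  - apply/allP => p pps; have [[_ /andP[Yp _]] _] := psP p pps.
    exact: (scale_V_lt h0 (supp_bound_gt0 mu) okY Yp (p0 _ pps)).
  - exact: (scale_m_gt0 okY).
  - exact: (scale_n_gt0 h0 okY).
  - apply/allP => p pps; have [[_ /andP[_ pY]] _] := psP p pps.
    exact: (scale_H_ge okY pY (p0 _ pps)).
have t0 : 0 < 2 / 3 * Y * threshold Y by rewrite !mulr_gt0 ?invr_gt0 ?exprn_gt0.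
rewrite -(ler_pM2r t0).
have -> : 3 / 2 * scale_A h * ln Y ^+ 3 / Num.sqrt Y * (2 / 3 * Y * threshold Y) =
    scale_A h * Y * ln Y.
  by rewrite /threshold; field; rewrite !gt_eqF.
apply: le_trans avg; rewrite mulr_suml big_seq [X in _ <= X]big_seq.
apply: ler_sum => p pps; have [[_ /andP[Yp _]] tp] := psP p pps.
have pi0 : 0 <= p%:R^-1 :> R by rewrite invr_ge0.
rewrite [X in X <= _]mulrC [X in _ <= X]mulrAC ler_wpM2r //.
apply: ler_pM; rewrite ?(ltW tp) ?(ltW Yp) //.
  by rewrite mulr_ge0 ?ltW // divr_ge0.
by rewrite /threshold divr_ge0 ?ltW ?exprn_gt0.
Qed.

Lemma sum_seq_fsbig (A : set nat) (F : nat -> R) N : (forall p, A p -> (p < N)%N) ->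
  exists ps : seq nat, [/\ uniq ps, forall p, p \in ps -> A p &
     \sum_(p \in A) F p = \sum_(p <- ps) F p].
Proof.
move=> AN; pose ps := [seq p <- iota 0 N | `[< A p >]].
have ups : uniq ps by rewrite filter_uniq ?iota_uniq.
exists ps; split=> //; first by move=> p; rewrite mem_filter => /andP[/asboolP].
have AE : A = [set` ps].
  apply/seteqP; split=> p /=.
    by move=> Ap; rewrite mem_filter mem_iota /= add0n AN // andbT; apply/asboolP.
  by rewrite mem_filter => /andP[/asboolP].
by rewrite [RHS]fsbig_seq // -AE.
Qed.

Definition scale (j : nat) : R := (3 / 2) ^+ j.

(** Keeping only scales beyond [Y1] lets the bound on reciprocals hold from [X = 1] on; primes of
    smaller scales are left to [p0]. *)
Definition exceptional (Y1 : R) : set nat :=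
  [set p | exists j, [/\ Y1 < scale j, in_scale (scale j) p &
                         threshold (scale j) < scale_roots (scale j) p]].

Lemma scale_ge1 j : 1 <= scale j.
Proof. by rewrite exprn_ege1 // ler_pdivlMr // mul1r ler_nat. Qed.

Lemma scale_le i j : (i <= j)%N -> scale i <= scale j.
Proof. by move=> ij; apply: ler_weXn2l => //; exact: (scale_ge1 1). Qed.

Lemma scale_unbounded (x : R) : exists j, x <= scale j.
Proof.
have [k xk] : exists k : nat, x <= k%:R.
  by exists (Num.truncn x).+1; rewrite ltW // truncnS_gt.
exists (2 * k)%N; apply: le_trans xk _.
elim: k => [|k IH]; first by rewrite exprn_ge0 // divr_ge0.
have E : scale (2 * k.+1) = 9 / 4 * scale (2 * k) by rewrite mulnS /scale exprD; field.
rewrite -[k.+1%:R]natr1 E; move: IH.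
have := scale_ge1 (2 * k).
by move: (scale _) (k%:R) => y x' *; lra.
Qed.

(** At most three scales matter for the window, and [exceptional_sum] applies to each. The sum is
    empty unless some scale beyond [Y1] reaches the window, so the conditions on [X] are only asked
    when [Y1 < 3 / 2 * X]. *)
Lemma window_bound (Y1 X : R) : (forall Y, Y1 < Y -> scale_ok h C0 Y) ->
  1 <= X -> (Y1 < 3 / 2 * X -> 2 <= X /\ 54 * scale_A h <= ln X ^+ 3) ->
  \sum_(p \in exceptional Y1 `&`
       [set p : nat | expR (X / 2) <= p%:R :> R /\ p%:R <= expR X]) (p%:R^-1 : R)
    <= ln X ^+ 6 / Num.sqrt X.
Proof.
move=> ok X1 HX; set A := _ `&` _.
have X0 : 0 < X by lra.
have h0 := H2_gt0.
have A0 := scale_A_gt0 h0.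
have [|ps [ups psA ->]] := @sum_seq_fsbig A (fun p => p%:R^-1) (Num.truncn (expR X)).+1.
  move=> p [_ [_ pX]]; rewrite -(ltr_nat R); apply: le_lt_trans pX _.
  exact: truncnS_gt.
have lnX0 : 0 <= ln X by rewrite ln_ge0.
have [->|psn] := eqVneq ps [::].
  by rewrite big_nil divr_ge0 ?exprn_ge0 ?sqrtr_ge0.
have win p : p \in ps -> X / 2 <= ln p%:R <= X.
  move=> /psA[[j [_ [pp _] _]] [lo hi]].
  have p0 : 0 < (p%:R : R) by rewrite ltr0n prime_gt0.
  by rewrite -ler_expR lnK // lo -ler_expR lnK.
have [X2 XA] : 2 <= X /\ 54 * scale_A h <= ln X ^+ 3.
  apply: HX; case: ps psn {ups} psA win => // p ps' _ psA win.
  have [[j [Yj1 [_ /andP[Yp _]] _]] _] := psA p (mem_head _ _).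
  have /andP[_ pX] := win p (mem_head _ _).
  by lra.
pose P j := `[< X / 2 <= scale j >].
have exP : exists j, P j by have [j Xj] := scale_unbounded (X / 2); exists j; apply/asboolP.
have [j0 /asboolP Xj0 j0min] := ex_minnP exP.
pose sub i := [seq p <- ps | `[< [/\ Y1 < scale (j0 + i), in_scale (scale (j0 + i)) p &
  threshold (scale (j0 + i)) < scale_roots (scale (j0 + i)) p] >]].
have cover p : p \in ps -> exists2 i : 'I_3, true & p \in sub i.
  move=> pps; have [[j [Yj1 [pp /andP[Yp pY]] rp]] _] := psA p pps.
  have /andP[lo hi] := win p pps.
  have j0j : (j0 <= j)%N by apply: j0min; apply/asboolP; apply: le_trans lo pY.
  (* [scale (j0 + 3)] is at least [27 / 16 * X], whereas [p] in scale [j] forces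
     [scale j < 3 / 2 * X]. *)
  have jj : (j - j0 < 3)%N.
    rewrite ltnNge; apply/negP => j3.
    have : scale (j0 + 3) <= scale j by rewrite scale_le // -leq_subRL.
    have -> : scale (j0 + 3) = 27 / 8 * scale j0 by rewrite /scale exprD; field.
    by lra.
  exists (Ordinal jj) => //; rewrite mem_filter pps andbT; apply/asboolP => /=.
  by rewrite subnKC //; split=> //; split=> //; apply/andP; split.
apply: (@le_trans _ _ (\sum_(i < 3) \sum_(p <- sub i) p%:R^-1)).
  under [X in _ <= X]eq_bigr do rewrite big_filter big_mkcond.
  rewrite exchange_big /= big_seq [X in _ <= X]big_seq; apply: ler_sum => p pps.
  have [i _ ip] := cover p pps.
  move: ip; rewrite mem_filter => /andP[ip _].
  rewrite (bigD1 i) //= ip lerDl; apply: sumr_ge0 => k _.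
  by case: ifP => // _; rewrite invr_ge0.
have sX : 0 < Num.sqrt X by rewrite sqrtr_gt0.
(* [18] is the product of [3 / 2] from [exceptional_sum], [8] from [ln Y <= 2 * ln X] cubed, and
   [3 / 2] from [sqrt Y >= 2 / 3 * sqrt X]. *)
apply: (@le_trans _ _ (\sum_(i < 3) (18 * scale_A h * ln X ^+ 3 / Num.sqrt X))); last first.
  rewrite sumr_const card_ord -[_ *+ 3]mulr_natl.
  have -> : 3%:R * (18 * scale_A h * ln X ^+ 3 / Num.sqrt X) =
            54 * scale_A h * ln X ^+ 3 / Num.sqrt X.
    by field; rewrite gt_eqF.
  rewrite ler_wpM2r ?invr_ge0 ?(ltW sX) // -[6%N]/(3 + 3)%N exprD.
  by rewrite ler_wpM2r // exprn_ge0.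
apply: ler_sum => i _.
have [->|] := eqVneq (sub i) [::].
  rewrite big_nil; rewrite divr_ge0 ?(ltW sX) // !mulr_ge0 ?exprn_ge0 //; exact: ltW.
case Es : (sub i) => [//|p q] _; rewrite -Es.
have : p \in sub i by rewrite Es mem_head.
rewrite mem_filter => /andP[/asboolP[Y1i [_ /andP[Yp _]] _] pps].
have /andP[_ pX] := win p pps.
set Y := scale (j0 + i) in Y1i Yp.
have okY := ok _ Y1i.
have XY : X / 2 <= Y.
  by apply: le_trans Xj0 _; rewrite scale_le // leq_addr.
apply: le_trans (exceptional_sum okY _ _) _.
- exact: filter_uniq.
- by move=> r; rewrite mem_filter => /andP[/asboolP[]].
case: okY => _ _ L1 _ _.
have Y0 : 0 < Y by lra.
have YX : Y <= X ^+ 2 by rewrite expr2; nra.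
have LX : ln Y <= 2 * ln X.
  by rewrite mulr_natl -lnXn // ler_ln ?posrE ?exprn_gt0.
have sY : 2 / 3 * Num.sqrt X <= Num.sqrt Y.
  have -> : 2 / 3 = Num.sqrt ((2 / 3) ^+ 2) :> R by rewrite sqrtr_sqr ger0_norm // divr_ge0.
  rewrite -sqrtrM ?sqr_ge0 // ler_wsqrtr //; lra.
have sY0 : 0 < Num.sqrt Y by apply: lt_le_trans sY; rewrite mulr_gt0 // divr_gt0.
have L3 : ln Y ^+ 3 <= 8 * ln X ^+ 3.
  have -> : 8 * ln X ^+ 3 = (2 * ln X) ^+ 3 by ring.
  have LY0 : 0 <= ln Y by lra.
  by rewrite lerXn2r ?nnegrE ?mulr_ge0.
have siY : (Num.sqrt Y)^-1 <= 3 / 2 * (Num.sqrt X)^-1.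
  rewrite -[X in X <= _]mul1r ler_pdivrMr // mulrAC ler_pdivlMr //; lra.
have LY3 : 0 <= ln Y ^+ 3 by rewrite exprn_ge0 // (le_trans ler01).
have := ler_pM LY3 (ltW (_ : 0 < (Num.sqrt Y)^-1)) L3 siY.
rewrite invr_gt0 => /(_ sY0) H.
have A1 : 0 <= 3 / 2 * scale_A h by rewrite mulr_ge0 ?divr_ge0 ?ltW.
have := ler_wpM2l A1 H.
by rewrite !mulrA => /le_trans; apply; lra.
Qed.

(** Mixing is reached at time [3 * scale_n h Y] by [sqnorm_centered_le], with [scale_m Y] distinct
    powers supplied by [expr_inj_notin]. *)
Lemma good_multiplier (Y eps delta : R) p (a : 'F_p) : scale_ok h C0 Y ->
  0 < eps -> 0 < delta -> 9216 / (eps ^+ 2 * delta ^+ 2) <= ln Y -> in_scale Y p ->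
  a \notin small_root p (scale_m Y) (scale_T h C0 Y) ->
  p%:R * sqnorm (law mu a (scale_n h Y)) <= 8 / eps * threshold Y ->
  (Tmix mu a delta <= T2mix mu a delta)%E /\
  (T2mix mu a delta <= (5 / h * ln p%:R)%:E)%E.
Proof.
move=> okY e0 d0 Led [pp /andP[Yp pY]] aE aS.
have h0 := H2_gt0; have [Y4 _ L1 _ _] := okY.
split; first by apply: Tmix_le_T2mix => //; exact: ltW.
have Y0 : 0 < Y by apply: lt_le_trans Y4.
have L0 : 0 < ln Y by apply: lt_le_trans L1.
have m0 := scale_m_gt0 okY.
have [a0 ainj] := expr_inj_notin pp m0 (scale_T_gt0 h0 (supp_bound_gt0 mu) okY) aE.
have S0 : 0 <= p%:R * sqnorm (law mu a (scale_n h Y)).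
  by rewrite mulr_ge0 //; apply: sumr_ge0 => x _; apply: sqr_ge0.
apply: (@le_trans _ _ ((3 * scale_n h Y)%N%:R%:E)); last first.
  rewrite lee_fin natrM.
  have := scale_n_le h0 okY; set N := (scale_n h Y)%:R => nY.
  have hV : 0 < h^-1 by rewrite invr_gt0.
  have : Y / h <= 3 / 2 * ln p%:R / h by rewrite ler_pM2r //; lra.
  have : 0 <= ln p%:R / h by rewrite divr_ge0 ?ltW // ln_gt0 // ltr1n prime_gt1.
  rewrite -mulrA -[5 / h * _]mulrA [h^-1 * _]mulrC.
  by move: (ln p%:R / h) (Y / h) nY => u v *; lra.
apply: T2mix_le; apply: le_trans (sqnorm_centered_le pp mu_prob (scale_m_le_n h0 okY) m0 a0 ainj) _.
have M0 : 0 < (scale_m Y)%:R :> R by rewrite ltr0n.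
rewrite ler_pdivrMr //.
apply: (@le_trans _ _ ((8 / eps * threshold Y) ^+ 2)).
  by rewrite lerXn2r ?nnegrE // (le_trans S0).
have -> : (8 / eps * threshold Y) ^+ 2 = 64 * Y / (eps ^+ 2 * ln Y ^+ 4).
  have t2 : threshold Y ^+ 2 = Y / ln Y ^+ 4.
    by rewrite /threshold expr_div_n sqr_sqrtr ?(ltW Y0) // -exprM.
  by rewrite exprMn t2; field; rewrite !gt_eqF.
have mY := scale_m_ge okY.
have d2 : 0 < delta ^+ 2 by rewrite exprn_gt0.
apply: le_trans (ler_wpM2l (ltW d2) mY).
have e2 : 0 < eps ^+ 2 by rewrite exprn_gt0.
have ed : 0 < eps ^+ 2 * delta ^+ 2 by rewrite mulr_gt0.
(* [9216 = 8 ^ 2 * 144], from [8 / eps] squared and the lower bound on [scale_m Y]. *)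
have L3 : 9216 / (eps ^+ 2 * delta ^+ 2) <= ln Y ^+ 3.
  by apply: le_trans Led _; rewrite -[X in X <= _]expr1 ler_weXn2l.
move: L3; rewrite ler_pdivrMr // => L3.
rewrite ler_pdivrMr ?mulr_gt0 ?exprn_gt0 // mulrA.
have -> : delta ^+ 2 * (Y / (144 * ln Y)) * eps ^+ 2 * ln Y ^+ 4 =
   (ln Y ^+ 3 * (eps ^+ 2 * delta ^+ 2)) * (Y / 144).
  by field; rewrite gt_eqF.
have -> : 64 * Y = 9216 * (Y / 144) by field.
by rewrite ler_wpM2r // divr_ge0 // ltW.
Qed.

(** A bad multiplier lies in [E], small by counting, or in [B2], controlled by Markov's inequality;
    each has at most [eps / 4 * p] elements. *)
Lemma bad_multipliers (Y eps delta : R) p : scale_ok h C0 Y ->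
  0 < eps -> 0 < delta -> 4 / eps <= expR (Y / 6) ->
  expR h ^+ 2 * ln Y ^+ 4 <= Y -> 9216 / (eps ^+ 2 * delta ^+ 2) <= ln Y ->
  in_scale Y p -> scale_roots Y p <= threshold Y ->
  #|[pred a : {unit 'F_p} |
     ~~ `[< (Tmix mu (val a) delta <= T2mix mu (val a) delta)%E /\
            (T2mix mu (val a) delta <= (5 / h * ln p%:R)%:E)%E >] ]|%:R
   <= eps * #|{: {unit 'F_p}}|%:R :> R.
Proof.
move=> okY e0 d0 eY hY Led sc rt; have [pp /andP[Yp pY]] := sc.
have h0 := H2_gt0; have [Y4 _ L1 _ _] := okY.
have Y0 : 0 < Y by apply: lt_le_trans Y4.
have L0 : 0 < ln Y by apply: lt_le_trans L1.
have p0 : 0 < (p%:R : R) by rewrite ltr0n prime_gt0.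
have p1 : 2 <= (p%:R : R) by rewrite (ler_nat _ 2) prime_gt1.
have pE : p%:R = expR (ln p%:R) :> R by rewrite lnK.
set n := scale_n h Y; set m := scale_m Y; set T := scale_T h C0 Y.
(* Since [p * sqnorm] sums to at most [2 * threshold Y * p], the factor [8 / eps] in [W] leaves a
   proportion [eps / 4] in Markov's inequality. *)
pose E := small_root p m T; pose W := 8 / eps * threshold Y.
have thr_h : expR h <= threshold Y.
  rewrite /threshold ler_pdivlMr ?exprn_gt0 //.
  have q0 : 0 <= expR h * ln Y ^+ 2 by rewrite mulr_ge0 ?expR_ge0 ?exprn_ge0 // ltW.
  rewrite -(ger0_norm q0) -sqrtr_sqr ler_wsqrtr //.
  by rewrite exprMn -exprM.
have thr0 : 0 < threshold Y by rewrite (lt_le_trans _ thr_h) ?expR_gt0.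
have W0 : 0 < W by rewrite /W mulr_gt0 // divr_gt0.
pose B2 := [set a : 'F_p | (a \notin E) && (W < p%:R * sqnorm (law mu a n))]%SET.
(* [p] exceeds [expR (2 / 3 * Y)], and the gap [expR (Y / 6)] above [expR (Y / 2)] pays for
   [4 / eps]. *)
have cE : #|E|%:R <= eps / 4 * p%:R.
  apply: (@le_trans _ _ (expR (Y / 2))).
    apply: le_trans (scale_small_roots h0 (supp_bound_gt0 mu) okY); rewrite ler_nat.
    have Tp := scale_T_lt h0 okY Yp (prime_gt0 pp).
    by have leE := card_small_root m pp Tp; exact: leE.
  apply: (@le_trans _ _ (eps / 4 * expR (2 / 3 * Y))).
    have -> : 2 / 3 * Y = Y / 6 + Y / 2 by field.
    rewrite expRD mulrA -[X in X <= _]mul1r ler_wpM2r ?expR_ge0 //.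
    rewrite -(ler_pM2l (divr_gt0 (ltr0n _ 4 : 0 < 4) e0)) mulr1 mulrA.
    suff -> : 4 / eps * (eps / 4) = 1 by rewrite mul1r.
    by field; rewrite gt_eqF.
  rewrite ler_wpM2l ?divr_ge0 ?(ltW e0) // pE ler_expR; exact: ltW.
have cB2 : #|B2|%:R <= eps / 4 * p%:R.
  have sumS : \sum_(a : 'F_p | a \notin E) sqnorm (law mu a n) <= 2 * threshold Y.
    apply: le_trans (sum_sqnorm_law mu n m T pp) _.
    (* Truncation only gives [n + 1 > Y / h]; the missing step costs the factor [expR h], which
       [thr_h] absorbs. *)
    have : p%:R * s ^+ n <= expR h.
      rewrite sum_sqrE -expRM_natl pE -expRD ler_expR.
      have /andP[_] := truncn_itv (ltW (divr_gt0 Y0 h0)).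
      rewrite -/(scale_n h Y) -/n -[n.+1%:R]natr1 ltr_pdivrMr // => nY.
      rewrite mulrDl mul1r in nY; rewrite mulrN lerBlDr addrC.
      exact: ltW (le_lt_trans pY nY).
    move=> ps; apply: le_trans (lerD rt ps) _.
    by rewrite mulr_natl mulr2n lerD2l.
  have : #|B2|%:R * (W / p%:R) <= 2 * threshold Y.
    apply: le_trans sumS; rewrite mulr_natl -sumr_const.
    rewrite big_mkcond [X in _ <= X]big_mkcond; apply: ler_sum => a _.
    rewrite inE; case: ifP => [/andP[-> Wa]|_].
      by rewrite ler_pdivrMr // mulrC ltW.
    by case: ifP => // _; apply: sumr_ge0 => x _; apply: sqr_ge0.
  rewrite mulrA ler_pdivrMr //.
  have -> : 2 * threshold Y * p%:R = eps / 4 * p%:R * W by rewrite /W; field; rewrite gt_eqF.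
  by rewrite ler_pM2r.
set Bad := [pred a | _].
have cBad : (#|Bad| <= #|E| + #|B2|)%N.
  have vi : injective (val : {unit 'F_p} -> 'F_p) by exact: val_inj.
  rewrite -(fintype.card_image vi Bad).
  apply: leq_trans (leq_card_setU _ _); apply: subset_leq_card.
  apply/fintype.subsetP => _ /fintype.imageP[a aB ->]; rewrite finset.in_setU.
  have [//|aE] := boolP (val a \in E); rewrite /= [_ \in B2]inE aE /=.
  rewrite ltNge; apply: contraL aB => aS; rewrite inE negbK; apply/asboolP.
  exact: (good_multiplier okY e0 d0 Led sc aE aS).
have -> : #|{: {unit 'F_p}}|%:R = p%:R - 1 :> R.
  by rewrite -cardsT card_finField_unit card_Fp // -subn1 natrB ?prime_gt0.
apply: (@le_trans _ _ (#|E|%:R + #|B2|%:R)); first by rewrite -natrD ler_nat.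
apply: le_trans (lerD cE cB2) _.
(* There are [p - 1] units, and [p / 2 <= p - 1] because [p >= 2]. *)
have -> : eps / 4 * p%:R + eps / 4 * p%:R = eps * (p%:R / 2) by field.
by rewrite ler_pM2l //; lra.
Qed.

(** [Y1] is taken beyond [3 / 2] times the point [X0] from which the conditions on [X] in
    [window_bound] hold. *)
Lemma exceptional_sparse : \forall Y1 \near +oo, forall X : R, 1 <= X ->
  \sum_(p \in exceptional Y1 `&`
       [set p : nat | expR (X / 2) <= p%:R :> R /\ p%:R <= expR X]) (p%:R^-1 : R)
    <= ln X ^+ 6 / Num.sqrt X.
Proof.
have [Y0 [_ okY]] := near_scale_ok h C0.
have [X0 [_ okX]] : \forall X \near +oo, 2 <= X /\ 54 * scale_A h <= ln X ^+ 3.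
  near=> X; split; first by near: X; exact: nbhs_pinfty_ge.
  have L1 : 1 <= ln X by near: X; exact: near_ln_ge.
  apply: (@le_trans _ _ (ln X)); first by near: X; exact: near_ln_ge.
  by rewrite -[X in X <= _]expr1 ler_weXn2l.
near=> Y1; move=> X X1; apply: window_bound => // [Y YY|XY].
  by apply: okY; apply: lt_trans YY; near: Y1; apply: nbhs_pinfty_gt; rewrite num_real.
have : 3 / 2 * X0 < Y1 by near: Y1; apply: nbhs_pinfty_gt; rewrite num_real.
by move=> XY1; apply: okX; lra.
Unshelve. all: by end_near.
Qed.

(** The scale of [p] is the first one with [ln p <= scale j]; minimality puts [ln p] above
    [scale j.-1], which is [2 / 3 * scale j]. *)
Lemma mixing_of_not_exceptional (Y1 eps delta : R) : 0 < eps -> 0 < delta ->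
  exists p0 : nat, forall p, prime p -> (p0 < p)%N -> ~ exceptional Y1 p ->
    #|[pred a : {unit 'F_p} |
       ~~ `[< (Tmix mu (val a) delta <= T2mix mu (val a) delta)%E /\
              (T2mix mu (val a) delta <= (5 / h * ln p%:R)%:E)%E >] ]|%:R
     <= eps * #|{: {unit 'F_p}}|%:R :> R.
Proof.
move=> e0 d0.
have [Z0 [_ okZ]] : \forall Y \near +oo, [/\ scale_ok h C0 Y, 4 / eps <= expR (Y / 6),
    expR h ^+ 2 * ln Y ^+ 4 <= Y, 9216 / (eps ^+ 2 * delta ^+ 2) <= ln Y & Y1 < Y].
  near=> Y; split; try by near: Y; apply: nbhs_pinfty_gt; rewrite num_real.
  - by near: Y; exact: near_scale_ok.
  - apply: le_trans (expR_ge1Dx _).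
    have : 6 * (4 / eps) <= Y by near: Y; apply: nbhs_pinfty_ge; rewrite num_real.
    by move: (4 / eps) => u; lra.
  - by near: Y; exact: near_ln_pow.
  - by near: Y; exact: near_ln_ge.
(* The maximum with [1 = scale 0] excludes [j = 0], which has no preceding scale. *)
exists (Num.truncn (expR (Num.max Z0 1))) => p pp p0 NB.
have pZ : Num.max Z0 1 < ln p%:R.
  rewrite -ltr_expR lnK ?posrE ?ltr0n ?prime_gt0 //.
  by apply: lt_le_trans (truncnS_gt _) _; rewrite ler_nat.
move: pZ; rewrite gt_max => /andP[pZ p1].
pose P j := `[< ln (p%:R : R) <= scale j >].
have exP : exists j, P j by have [j pj] := scale_unbounded (ln p%:R); exists j; apply/asboolP.
have [j /asboolP pj jmin] := ex_minnP exP.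
have sc : in_scale (scale j) p.
  split=> //; rewrite pj andbT.
  case: j pj jmin => [|j] pj jmin; first by move: pj; rewrite /scale expr0; lra.
  have -> : 2 / 3 * scale j.+1 = scale j by rewrite /scale exprS; field.
  rewrite ltNge; apply/negP => pj'.
  by have := jmin j (asboolT pj'); rewrite ltnn.
have [ok1 ok2 ok3 ok4 ok5] := okZ (scale j) (lt_le_trans pZ pj).
apply: (bad_multipliers ok1 e0 d0 ok2 ok3 ok4 sc).
by rewrite leNgt; apply/negP => rj; apply: NB; exists j.
Unshelve. all: by end_near.
Qed.

End Main.

Local Open Scope classical_set_scope.
Local Open Scope ring_scope.

Theorem theorem2 (R : realType) (mu : {fsfun int -> R with 0})
    (mu_prob : is_probability mu) (mu_supp : (2 <= #|` finsupp mu|)%N) :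
  exists B : set nat,
    [/\ (forall p : nat, B p -> prime p),
        (forall X : R, 1 <= X ->
           \sum_(p \in B `&` [set p : nat |
                                expR (X / 2) <= p%:R :> R /\ p%:R <= expR X])
             (p%:R^-1 : R)
           <= ln X ^+ 6 / Num.sqrt X) &
        (forall eps delta : R, 0 < eps < 1 -> 0 < delta < 1 ->
           exists p0 : nat, forall p : nat, prime p -> (p0 < p)%N -> ~ B p ->
             #|[pred a : {unit 'F_p} |
                  ~~ `[< (Tmix mu (val a) delta <= T2mix mu (val a) delta)%E /\
                         (T2mix mu (val a) delta
                            <= (5 / H2 mu * ln p%:R)%:E)%E >] ]|%:R
               <= eps * #|{: {unit 'F_p}}|%:R)].
Proof.
have [Y1 _ sparse] := pinfty_ex_gt0 (exceptional_sparse mu_prob mu_supp).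
exists (exceptional mu Y1); split => [p [j [_ []]]||eps delta /andP[e0 _] /andP[d0 _]] //.
exact: mixing_of_not_exceptional.
Qed.
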